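(* There exists a minimal 4-interval exchange transformation $T:[0,1)\to[0,1)$ with two (distinct) ergodic invariant Borel probability measures $\lambda_2$ and $\lambda_3$ such that, with $d=d_{\lambda_2+\lambda_3}$, for any $\epsilon>0$ we have $$\liminf_{n\to\infty} n^{1-\epsilon}\,d(T^nx,y)=0\quad\text{for }\lambda_2\times\lambda_3\text{-almost every }(x,y)$$ and $$\liminf_{n\to\infty} n^{\frac12+\epsilon}\,d(T^nx,y)=\infty\quad\text{for }\lambda_3\times\lambda_2\text{-almost every }(x,y).$$
   Context: A 4-interval exchange transformation is a map $T:[0,1)\to[0,1)$ given by lengths $l_1,\dots,l_4>0$ with $\sum l_i=1$ and a permutation $\pi$ of $\{1,\dots,4\}$: with $I_j=[l_1+\dots+l_{j-1},\,l_1+\dots+l_j)$, $T(x)=x-\sum_{k<j}l_k+\sum_{\pi(k')<\pi(j)}l_{k'}$ for $x\in I_j$. $T$ is minimal if every orbit is dense. The metric $d_{\lambda_2+\lambda_3}$ on $[0,1)$ is $d_{\lambda_2+\lambda_3}(a,b)=\lambda_2([a,b])+\lambda_3([a,b])$ for $a\le b$. *)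

(* Defs.v *)
From mathcomp Require Import all_boot all_order all_algebra all_fingroup.
From mathcomp Require Import all_classical all_reals all_analysis.

Set Implicit Arguments.
Unset Strict Implicit.
Unset Printing Implicit Defensive.

Import Order.TTheory GRing.Theory Num.Theory.
Import numFieldNormedType.Exports.

Local Open Scope classical_set_scope.
Local Open Scope ring_scope.

Definition iet_lengths (R : realType) (m : nat) (l : 'I_m -> R) : Prop :=
  (forall j, 0 < l j) /\ \sum_(j < m) l j = 1.

Definition iet_itv (R : realType) (m : nat) (l : 'I_m -> R) (j : 'I_m) :
    interval R :=
  `[\sum_(k < m | (k < j)%N) l k, \sum_(k < m | (k <= j)%N) l k[.

(* For lengths satisfying [iet_lengths] the intervals [iet_itv l j] partition
   [0, 1), so at most one [j] can be picked. The map is extended by the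
   identity outside [0, 1), so that both [0, 1) and its complement are
   preserved by the map. *)
Definition iet (R : realType) (m : nat) (l : 'I_m -> R) (s : 'S_m) (x : R) : R :=
  if [pick j | x \in iet_itv l j] is Some j then
    x - \sum_(k < m | (k < j)%N) l k + \sum_(k < m | (s k < s j)%N) l k
  else x.

Definition minimal_on01 (R : realType) (T : R -> R) : Prop :=
  forall x : R, x \in `[0, 1[ ->
    `[0, 1[%classic `<=` closure (range (fun n : nat => iter n T x)).

(* A Borel probability measure on [0, 1) is represented as a Borel probability
   measure on R that gives mass 1 to [0, 1). For a map preserving [0, 1) and
   its complement, invariance and ergodicity may then be tested on Borel
   subsets of R. *)
Definition invariant_on01 (R : realType) (T : R -> R)
    (lam : probability (measurableTypeR R) R) : Prop :=
  lam `[0, 1[%classic = 1%E /\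
  forall A : set (measurableTypeR R), measurable A -> lam (T @^-1` A) = lam A.

Definition ergodic_on01 (R : realType) (T : R -> R)
    (lam : probability (measurableTypeR R) R) : Prop :=
  invariant_on01 T lam /\
  forall A : set (measurableTypeR R), measurable A -> T @^-1` A = A ->
    lam A = 0%E \/ lam A = 1%E.

Definition dist_sum (R : realType)
    (lam mu : probability (measurableTypeR R) R) (a b : R) : \bar R :=
  let J := `[Num.min a b, Num.max a b]%classic in (lam J + mu J)%E.

(* Main.v *)
(** We use Keane's construction with rapidly growing parameters. The map induced
    on the fourth interval is, with the orientation reversed, an exchange of the
    same type, and its lengths determine the original ones through a matrix
    depending on two parameters m, n. At stage k the interval is thus cut into four
    towers of heights h_1, ..., h_4. Tower 2 of stage k+1 consists mostly of copies
    of tower 2 of stage k, and tower 3 mostly of copies of tower 3, so almost every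
    point ends up either in towers 1 and 2 or in towers 3 and 4; both alternatives
    have positive Lebesgue measure, and the two measures are the normalised
    restrictions of Lebesgue measure to these two invariant sets. In particular
    d(a, b) is comparable with |a - b|. Ergodicity holds because an invariant set
    has the same density in all the levels of a tower that fills the space.

    We take n_k to be a large power (of exponent k + 6) of Q_k = 2^(k+6) h_2 and
    m_k = 2^(k+6) n_k. Before time about h_{k+1} <= 5 Q_k n_k every orbit crosses
    the whole third tower of stage k with step at most 1/n_k, whence the first
    limit. On the other hand the second measure gives to tower 2 of stage k a mass
    smaller than Q_{k+1}^(-4): almost every x avoids it until time Q_{k+1}^4, for
    all large k, while almost every y is in it, at distance at least 1/Q_k from its
    complement. For Q_k^4 <= n < Q_{k+1}^4 this makes n^(1/2) d(T^n x, y) at least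
    Q_k, whence the second limit. *)

Require Import Defs.
From mathcomp Require Import all_boot all_order all_algebra all_fingroup.
From mathcomp Require Import all_classical all_reals all_analysis.
From mathcomp Require Import measurable_realfun.
From mathcomp Require Import ring lra zify.

Set Implicit Arguments.
Unset Strict Implicit.
Unset Printing Implicit Defensive.

Import Order.TTheory GRing.Theory Num.Theory.
Import numFieldNormedType.Exports.

Local Open Scope classical_set_scope.
Local Open Scope ring_scope.

(** * One step of Keane's induction *)

(** Heights and lengths are computed in opposite directions: the heights of stage k come from the
    parameters of the stages before k, the lengths of stage k from those of stage k+1. So the
    parameters can be chosen along with the heights, before any length exists, and the lengths are
    then found by compactness. That argument keeps the mass of towers 1 and 2 and the mass of towers
    3 and 4 both at most 5/8, so that Lebesgue measure lies well inside the segment joining the two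
    ergodic measures, whose densities are then at most 4.

    The ratio m_k / n_k is a compromise. Its inverses must be summable, since the copies of towers 3
    and 4 inside towers 1 and 2 have a relative mass of order at most n_k / m_k; yet it must be
    small against the powers of n_k, so that the return times of stage k+1 hardly exceed n_k. The
    exponent k + 6 is unbounded because (Q_k n_k)^(1-eps) / n_k has to tend to 0 for every eps > 0.
    In the other direction a single copy of tower 1 enters towers 3 and 4, against about n_k copies
    of tower 3: this leak is far smaller. *)

Inductive letter := L1 | L2 | L3 | L4.

(* The itinerary, until its return to the fourth interval, of a point of the
   [i]-th interval of the induced map. *)
Definition word (m n : nat) (i : letter) : seq letter :=
  L4 :: match i with
        | L1 => nseq m L2 ++ nseq n.+1 L3
        | L2 => nseq m.+1 L2 ++ nseq n.+1 L3
        | L3 => L1 :: nseq n L3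
        | L4 => L1 :: nseq n.+1 L3
        end.

Section KeaneStep.
Variable R : realType.
Implicit Types (b : bool) (l v : letter -> R) (u x y : R).

Definition total l := l L1 + l L2 + l L3 + l L4.

(* Keane's matrix $A_{m+1,n+1}$ applied to [v]: the lengths whose induced map on
   the fourth interval has lengths [v]. *)
Definition keane (m n : nat) v (i : letter) : R :=
  match i with
  | L1 => v L3 + v L4
  | L2 => m%:R * v L1 + m.+1%:R * v L2
  | L3 => n.+1%:R * (v L1 + v L2 + v L4) + n%:R * v L3
  | L4 => total v
  end.

(* Inducing on the fourth interval reverses the orientation, so that the
   intervals are alternately of the form [x, y[ ([b = true]) and ]x, y]
   ([b = false]). *)
Definition ble b x y := if b then x <= y else x < y.
Definition blt b x y := if b then x < y else x <= y.

Definition cut l i :=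
  match i with
  | L1 => 0 | L2 => l L1 | L3 => l L1 + l L2 | L4 => l L1 + l L2 + l L3
  end.

Definition shift_by l i :=
  match i with
  | L1 => l L4 + l L2 | L2 => l L4 - l L1 | L3 => l L4
  | L4 => - (l L1 + l L2 + l L3)
  end.

Definition in_piece b l i u := ble b (cut l i) u && blt b u (cut l i + l i).
Definition in_dom b l u := ble b 0 u && blt b u (total l).

Definition letter_at b l u :=
  if blt b u (cut l L2) then L1 else if blt b u (cut l L3) then L2
  else if blt b u (cut l L4) then L3 else L4.

(* The images of the four intervals are ordered as 4, 2, 1, 3. *)
Definition exchange b l u := u + shift_by l (letter_at b l u).

Lemma bltN b x y : ~~ blt b x y = ble b y x.
Proof. by case: b; rewrite /= -?leNgt -?ltNge. Qed.

Lemma letter_at_in b l u : in_dom b l u -> in_piece b l (letter_at b l u) u.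
Proof.
rewrite /in_dom /in_piece /letter_at => /andP[u0 ut].
case: ifPn => [u1|]; first by rewrite u0 /= add0r.
rewrite bltN => u1; case: ifPn => [u2|]; first by rewrite u1.
rewrite bltN => u2; case: ifPn => [u3|]; first by rewrite u2.
by rewrite bltN => u3; rewrite u3.
Qed.

End KeaneStep.

Ltac blra b := destruct b; change (~~ true) with false in *;
  change (~~ false) with true in *; cbv beta iota delta [ble blt] in *; lra.

Section KeaneStep.
Variable R : realType.
Implicit Types (b : bool) (l v : letter -> R) (u x y : R).

Lemma in_letter_at b l i u :
  (forall j, 0 < l j) -> in_piece b l i u -> letter_at b l u = i.
Proof.
move=> l0; have [[[l1 l2] l3] l4] := (l0 L1, l0 L2, l0 L3, l0 L4).
rewrite /in_piece /letter_at => /andP[].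
by case: i => /= h1 h2; do ?case: ifPn => // ?; exfalso; clear l0; blra b.
Qed.

Lemma in_piece_dom b l i u : (forall j, 0 < l j) -> in_piece b l i u -> in_dom b l u.
Proof.
move=> l0; have [[[l1 l2] l3] l4] := (l0 L1, l0 L2, l0 L3, l0 L4).
rewrite /in_piece /in_dom /total => /andP[].
by clear l0; case: i => /= h1 h2; blra b.
Qed.

Lemma exchange_in b l i u :
  (forall j, 0 < l j) -> in_piece b l i u -> exchange b l u = u + shift_by l i.
Proof. by move=> l0 h; rewrite /exchange (in_letter_at l0 h). Qed.

Lemma exchange_dom b l u :
  (forall j, 0 < l j) -> in_dom b l u -> in_dom b l (exchange b l u).
Proof.
move=> l0 /letter_at_in; rewrite /exchange /in_piece /in_dom /total => /andP[].
have [[[l1 l2] l3] l4] := (l0 L1, l0 L2, l0 L3, l0 L4).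
by clear l0; case: letter_at => /= h1 h2; blra b.
Qed.

Lemma exchange_inj b l x y :
  (forall j, 0 < l j) -> in_dom b l x -> in_dom b l y ->
  exchange b l x = exchange b l y -> x = y.
Proof.
move=> l0 /letter_at_in + /letter_at_in; rewrite /exchange /in_piece => /andP[] + + /andP[].
have [[[l1 l2] l3] l4] := (l0 L1, l0 L2, l0 L3, l0 L4).
by clear l0; case: letter_at; case: letter_at => /= h1 h2 h3 h4 h5; blra b.
Qed.

Fixpoint follows b l (w : seq letter) u : Prop :=
  if w is a :: w' then in_piece b l a u /\ follows b l w' (exchange b l u) else True.

Lemma follows_cat b l w1 w2 u :
  follows b l w1 u -> follows b l w2 (iter (size w1) (exchange b l) u) ->
  follows b l (w1 ++ w2) u.
Proof.
elim: w1 u => //= a w1 IH u [ha h1] h2; split => //.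
by apply: IH => //; rewrite -iterSr.
Qed.

Lemma follows_nth b l w u q : follows b l w u -> (q < size w)%N ->
  in_piece b l (nth L1 w q) (iter q (exchange b l) u).
Proof.
elim: w u q => //= a w IH u [|q] [ha hw] // qw.
by rewrite iterSr; apply: IH.
Qed.

(** The displacement is nonnegative, so only the first point and the last one, $u + (q-1)d$, need
    checking. The last hypothesis is the bound on the latter with $d$ added to both sides, which
    avoids a predecessor and suits the induction. *)
Lemma follows_nseq b l i u q : (forall j, 0 < l j) -> 0 <= shift_by l i ->
  ble b (cut l i) u ->
  blt b (u + q%:R * shift_by l i) (cut l i + l i + shift_by l i) ->
  follows b l (nseq q i) u /\
  iter q (exchange b l) u = u + q%:R * shift_by l i.
Proof.
move=> l0 d0; elim: q u => [|q IH] u h1 h2; first by rewrite /= mul0r addr0.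
have qd : 0 <= q%:R * shift_by l i by rewrite mulr_ge0.
move: h2; rewrite -natr1 mulrDl mul1r => h2.
have hu : in_piece b l i u by rewrite /in_piece h1 /=; clear - h2 qd; blra b.
rewrite iterSr /= (exchange_in l0 hu).
have [||h3 h4] := IH (u + shift_by l i).
- by clear - h1 d0; blra b.
- by clear - h2; blra b.
split=> //; rewrite h4; ring.
Qed.

Section Induction.
Variables (b : bool) (m n : nat) (l v : letter -> R).
Hypotheses (v0 : forall j, 0 < v j) (lE : forall j, l j = keane m n v j).

Lemma keane_gt0 : forall j, 0 < l j.
Proof.
have [[[v1 v2] v3] v4] := (v0 L1, v0 L2, v0 L3, v0 L4).
case; rewrite lE /= ?/total.
- lra.
- by rewrite ltr_wpDl// ?mulr_ge0 ?mulr_gt0 // ltW.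
- by rewrite ltr_wpDr// ?mulr_ge0 ?mulr_gt0 ?addr_gt0// ltW.
- lra.
Qed.

Let l0 := keane_gt0.

(** Since [l L4 = total v], the reflection carries the fourth interval onto the domain of [v]; it
    exchanges the closed end and the open one, whence [~~ b]. *)
Lemma in_piece_L4 u : in_piece b l L4 u = in_dom (~~ b) v (total l - u).
Proof.
rewrite /in_piece /in_dom /= /total.
have -> : l L4 = v L1 + v L2 + v L3 + v L4 by rewrite lE.
by case: b => /=; apply/andP/andP => -[? ?]; split; lra.
Qed.

(* [total l - u] is the coordinate on the fourth interval after the reversal of
   orientation. *)
Lemma follows_word i u : in_piece (~~ b) v i (total l - u) ->
  follows b l (word m n i) u /\
  iter (size (word m n i)) (exchange b l) u =
    total l - exchange (~~ b) v (total l - u).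
Proof.
move=> hi.
have h4 : in_piece b l L4 u by rewrite in_piece_L4; exact: in_piece_dom hi.
have [[[v1 v2] v3] v4] := (v0 L1, v0 L2, v0 L3, v0 L4).
have E1 : l L1 = v L3 + v L4 by rewrite lE.
have E2 : l L2 = m%:R * v L1 + (m%:R + 1) * v L2 by rewrite lE /= -natr1.
have E3 : l L3 = (n%:R + 1) * (v L1 + v L2 + v L4) + n%:R * v L3.
  by rewrite lE /= -natr1.
have E4 : l L4 = v L1 + v L2 + v L3 + v L4 by rewrite lE.
have k1 : 0 <= m%:R * v L1 by rewrite mulr_ge0 // ltW.
have k2 : 0 <= m%:R * v L2 by rewrite mulr_ge0 // ltW.
have k3 : 0 <= n%:R * v L3 by rewrite mulr_ge0 // ltW.
move: (hi); rewrite /in_piece => /andP[].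
rewrite (exchange_in v0 hi).
have d20 : 0 <= shift_by l L2 by rewrite /=; lra.
have d30 : 0 <= shift_by l L3 by rewrite ltW//; exact: l0.
have e4 : exchange b l u = u - (l L1 + l L2 + l L3) by rewrite (exchange_in l0 h4).
have H : forall i w, word m n i = L4 :: w -> follows b l w (exchange b l u) ->
  follows b l (word m n i) u by move=> j w ->.
have Hi : forall i w, word m n i = L4 :: w ->
  iter (size (word m n i)) (exchange b l) u = iter (size w) (exchange b l) (exchange b l u).
  by move=> j w -> /=; rewrite -iterSr.
(* After the first step the four pieces lie in $[0, l_4]$ in the order 4, 3, 2, 1. Pieces 4 and 3
   fill the first interval, as [l L1 = v L3 + v L4]; pieces 2 and 1 begin the second interval and
   together have the length of its displacement, so their translates go on to tile it. *)
have dE : l L4 - l L1 = v L1 + v L2 by rewrite E1 E4; ring.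
rewrite /total.
case: i hi => hi; cbn [cut shift_by]; rewrite /total => h1 h2; rewrite (Hi _ _ erefl);
  set t := exchange b l u; cbn [shift_by] in d20, d30.
- have [||f2 g2] := @follows_nseq b l L2 t m l0 d20.
  + by rewrite /t e4 /=; rewrite ?dE ?E4; clear H Hi; blra b.
  + by rewrite /t e4 /=; rewrite ?dE ?E4; clear H Hi; blra b.
  have [||f3 g3] := @follows_nseq b l L3 (t + m%:R * shift_by l L2) n.+1 l0 d30.
  + by rewrite /t e4 /=; rewrite ?dE ?E4; clear H Hi; blra b.
  + by rewrite /t e4 /= -natr1; rewrite ?dE ?E4; clear H Hi; blra b.
  split; first by apply: (H _ _ erefl); apply: follows_cat f2 _; rewrite size_nseq g2.
  rewrite size_cat !size_nseq addnC iterD g2 g3 /t e4 /= -natr1;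
  rewrite ?dE ?E4; lra.
- have [||f2 g2] := @follows_nseq b l L2 t m.+1 l0 d20.
  + by rewrite /t e4 /=; rewrite ?dE ?E4; clear H Hi; blra b.
  + by rewrite /t e4 /= -natr1; rewrite ?dE ?E4; clear H Hi; blra b.
  have [||f3 g3] := @follows_nseq b l L3 (t + m.+1%:R * shift_by l L2) n.+1 l0 d30.
  + by rewrite /t e4 /= -natr1; rewrite ?dE ?E4; clear H Hi; blra b.
  + by rewrite /t e4 /= -!natr1; rewrite ?dE ?E4; clear H Hi; blra b.
  split; first by apply: (H _ _ erefl); apply: follows_cat f2 _; rewrite size_nseq g2.
  rewrite size_cat !size_nseq addnC iterD g2 g3 /t e4 /= -!natr1;
  rewrite ?dE ?E4; lra.
- have h : in_piece b l L1 t.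
    by rewrite /in_piece /t e4 /=; rewrite ?dE ?E4; clear H Hi; blra b.
  have eh := exchange_in l0 h.
  have [||f3 g3] := @follows_nseq b l L3 (exchange b l t) n l0 d30.
  + by rewrite eh /t e4 /=; rewrite ?dE ?E4; clear H Hi; blra b.
  + by rewrite eh /t e4 /=; rewrite ?dE ?E4; clear H Hi; blra b.
  split; first by apply: (H _ _ erefl).
  rewrite (_ : size _ = n.+1) ?iterSr ?g3 ?eh /=; last by rewrite size_nseq.
  rewrite ?eh /t e4 /=;
  rewrite ?dE ?E4; lra.
- have h : in_piece b l L1 t.
    by rewrite /in_piece /t e4 /=; rewrite ?dE ?E4; clear H Hi; blra b.
  have eh := exchange_in l0 h.
  have [||f3 g3] := @follows_nseq b l L3 (exchange b l t) n.+1 l0 d30.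
  + by rewrite eh /t e4 /=; rewrite ?dE ?E4; clear H Hi; blra b.
  + by rewrite eh /t e4 /= -natr1; rewrite ?dE ?E4; clear H Hi; blra b.
  split; first by apply: (H _ _ erefl).
  rewrite (_ : size _ = n.+2) ?[iter n.+2 _ _]iterSr ?g3 ?eh /=; last by rewrite size_nseq.
  rewrite ?eh /t e4 /= -natr1;
  rewrite ?dE ?E4; lra.
Qed.

Definition swept u := exists u0 q, in_piece b l L4 u0 /\ u = iter q (exchange b l) u0.

Lemma swept_next u i : swept u -> in_piece b l i u -> swept (u + shift_by l i).
Proof.
move=> [u0 [q [h ->]]] hi; exists u0, q.+1; split => //=.
by rewrite (exchange_in l0 hi).
Qed.

(* Going backwards, a point moves monotonically inside the second and third
   intervals until it leaves them, so its past meets the fourth interval. *)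
Lemma sweptP u : in_dom b l u -> swept u.
Proof.
have E1 : l L1 = v L3 + v L4 by rewrite lE.
have E4 : l L4 = v L1 + v L2 + v L3 + v L4 by rewrite lE.
have [[[v1 v2] v3] v4] := (v0 L1, v0 L2, v0 L3, v0 L4).
have [[[l1 l2] l3] l4] := (l0 L1, l0 L2, l0 L3, l0 L4).
have swI4 x : in_piece b l L4 x -> swept x by move=> hx; exists x, 0%N.
have prev i x : swept (x - shift_by l i) -> in_piece b l i (x - shift_by l i) -> swept x.
  by move=> /swept_next h /h; rewrite subrK.
have fromI4 x : ble b 0 x -> blt b x (l L4) -> swept x.
  move=> h1 h2; have hI : in_piece b l L4 (x - shift_by l L4).
    by rewrite /in_piece /=; blra b.
  by apply: (prev L4) => //; exact: swI4.
have swI1 x : in_piece b l L1 x -> swept x.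
  by rewrite /in_piece /= => /andP[h1 h2]; apply: fromI4 => //; blra b.
have swI2 x : in_piece b l L2 x -> swept x.
  have d0 : 0 < l L4 - l L1 by lra.
  have [N xN] : exists N : nat, x < N%:R * (l L4 - l L1).
    exists (Num.bound `|x / (l L4 - l L1)|).
    rewrite -ltr_pdivrMr//; apply: le_lt_trans (ler_norm _) _.
    exact: archi_boundP.
  elim: N x xN => [|N IH] x xN hx.
    move: hx xN; rewrite /in_piece /= mul0r => /andP[h _] h'; exfalso.
    by blra b.
  have [h4|] := boolP (blt b x (l L4)).
    by apply: fromI4 => //; case/andP: hx => /= + _; move=> h; blra b.
  rewrite bltN => h4.
  have hI : in_piece b l L2 (x - shift_by l L2).
    case/andP: hx => /= h1 h2; rewrite /in_piece /=.
    by blra b.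
  apply: (prev L2) => //; apply: IH => //.
  by move: xN; rewrite -natr1 /=; lra.
have swI3 x : in_piece b l L3 x -> swept x.
  have [N xN] : exists N : nat, x < N%:R * l L4.
    exists (Num.bound `|x / l L4|).
    rewrite -ltr_pdivrMr//; apply: le_lt_trans (ler_norm _) _.
    exact: archi_boundP.
  elim: N x xN => [|N IH] x xN hx.
    move: hx xN; rewrite /in_piece /= mul0r => /andP[h _] h'; exfalso.
    by blra b.
  case/andP: hx => /= h1 h2.
  (* The images of the pieces tile the domain in the order 4, 2, 1, 3, so the position of [x] tells
     which piece contains its preimage. *)
  have [h0|] := boolP (blt b x (l L4)).
    by apply: fromI4 => //; blra b.
  rewrite bltN => h0.
  have [h4|] := boolP (blt b x (l L4 + l L2)).
    have hI : in_piece b l L2 (x - shift_by l L2).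
      by rewrite /in_piece /=; blra b.
    by apply: (prev L2) => //; exact: swI2.
  rewrite bltN => h4; have [h5|] := boolP (blt b x (l L4 + l L2 + l L1)).
    have hI : in_piece b l L1 (x - shift_by l L1).
      by rewrite /in_piece /=; blra b.
    by apply: (prev L1) => //; exact: swI1.
  rewrite bltN => h5.
  have hI : in_piece b l L3 (x - shift_by l L3).
    by rewrite /in_piece /=; blra b.
  apply: (prev L3) => //; apply: IH => //.
  by move: xN; rewrite -natr1 /=; lra.
move=> /letter_at_in; case: letter_at; [exact: swI1|exact: swI2|exact: swI3|exact: swI4].
Qed.

(** The final run of [L3] is entered from [L1] or [L2], and from either of them a point of the third
    interval is reached within [l L4] of its left end. *)
Lemma word_tail i : (0 < m)%N -> exists w a N, [/\ word m n i = w ++ a :: nseq N L3,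
  a = L1 \/ a = L2 & (n <= N)%N].
Proof.
move=> m0; case: i; rewrite /word.
- exists (L4 :: nseq m.-1 L2), L2, n.+1; split; [|by right|by []].
  by rewrite -{1}(prednK m0) -addn1 nseqD -catA.
- exists (L4 :: nseq m L2), L2, n.+1; split; [|by right|by []].
  by rewrite -addn1 nseqD -catA.
- by exists [:: L4], L1, n; split => //; left.
- by exists [:: L4], L1, n.+1; split => //; left.
Qed.

(* The visits to the third interval form an arithmetic progression of step
   [l L4] that crosses it entirely. *)
Lemma visit_near u0 i u : (0 < m)%N -> (0 < n)%N ->
  in_piece (~~ b) v i (total l - u0) -> in_piece b l L3 u ->
  exists2 q, (q < size (word m n i))%N &
    in_piece b l L3 (iter q (exchange b l) u0) /\
    `|iter q (exchange b l) u0 - u| <= l L4.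
Proof.
move=> m0 n0 hi hu.
have [[[l1 l2] l3] l4] := (l0 L1, l0 L2, l0 L3, l0 L4).
have [fol fin] := follows_word hi.
have [w [a [N [wE aE nN]]]] := word_tail i m0.
have N0 : (0 < N)%N by exact: leq_trans nN.
have sz : size (word m n i) = ((size w).+1 + N)%N.
  by rewrite wE size_cat /= size_nseq addSnnS.
have at_a : in_piece b l a (iter (size w) (exchange b l) u0).
  have := follows_nth fol (q := size w).
  rewrite wE nth_cat ltnn subnn /=; apply.
  by rewrite size_cat /= -addSnnS leq_addr.
pose u1 := iter (size w).+1 (exchange b l) u0.
have at_3 r : (r < N)%N -> in_piece b l L3 (iter ((size w).+1 + r) (exchange b l) u0).
  move=> rN; have := follows_nth fol (q := (size w).+1 + r).
  rewrite sz ltn_add2l => /(_ rN).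
  rewrite {1}wE nth_cat ltnNge leqW ?leq_addr//= addSn subSn ?leq_addr// addnC addnK /=.
  by rewrite nth_nseq rN addnC.
have u1E r : (r <= N)%N -> iter ((size w).+1 + r) (exchange b l) u0 = u1 + r%:R * l L4.
  elim: r => [|r IH] rN; first by rewrite addn0 mul0r addr0.
  rewrite addnS iterS (exchange_in l0 (at_3 r rN)) IH 1?ltnW //= -natr1; ring.
have u1lt : blt b u1 (cut l L3 + l L4).
  rewrite /u1 iterS (exchange_in l0 at_a).
  move: at_a; rewrite /in_piece => /andP[_].
  by case: aE => -> /= h; blra b.
(* At the end of the word the point is back in the fourth interval, so the progression has run past
   the whole third interval. *)
have fin4 : ble b (cut l L4) (u1 + N%:R * l L4).
  rewrite -u1E// -sz fin.
  have : in_dom (~~ b) v (exchange (~~ b) v (total l - u0)).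
    by apply: exchange_dom => //; exact: in_piece_dom hi.
  rewrite -{1}[exchange _ _ _](subKr (total l)) -in_piece_L4.
  by case/andP.
move: (hu); rewrite /in_piece => /andP[hu1 hu2].
(* The least such [r] gives the last point of the progression not beyond [u]. Only when [r = 0] may
   that point lie beyond [u], and it is then within [l L4] of the left end. *)
have ex : exists r, blt b u (u1 + r.+1%:R * l L4).
  exists N; rewrite -natr1; move: hu2 fin4 => /=.
  by blra b.
case: (ex_minnP ex) => r hr rmin.
have rN : (r < N)%N.
  rewrite ltnNge; apply/negP => Nr.
  have : blt b u (u1 + N.-1.+1%:R * l L4).
    by rewrite prednK//; move: hu2 fin4 => /=; blra b.
  by move=> /rmin; rewrite leqNgt (leq_trans _ Nr) // prednK.
exists ((size w).+1 + r)%N; first by rewrite sz ltn_add2l.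
split; first exact: at_3.
rewrite u1E 1?ltnW//.
have lo : r = 0%N \/ ble b (u1 + r%:R * l L4) u.
  case: r hr rmin {rN} => [|r] hr rmin; first by left.
  right; rewrite -bltN; apply/negP => /rmin; by rewrite ltnn.
move: hr; rewrite -natr1 => hr; move: u1lt hu1 hu2 hr lo => /=.
move=> u1lt hu1 hu2 hr [r0|lo].
  by subst r; rewrite mul0r addr0 add0r mul1r in hr *; rewrite ler_norml; blra b.
by rewrite ler_norml; blra b.
Qed.

End Induction.

End KeaneStep.

(** * Towers over the successive induced maps *)

Fixpoint height (m n : nat -> nat) k i : nat :=
  if k is k'.+1 then sumn [seq height m n k' a | a <- word (m k') (n k') i]
  else 1%N.

Section Tower.
Variables (R : realType) (m n : nat -> nat) (v : nat -> letter -> R) (T : R -> R).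
Hypotheses (m0 : forall k, (0 < m k)%N) (n0 : forall k, (0 < n k)%N).
Hypotheses (v0 : forall k i, 0 < v k i)
  (vE : forall k i, v k i = keane (m k) (n k) (v k.+1) i).
Hypotheses (iet_map_exchange : forall x, in_dom true (v 0%N) x -> T x = exchange true (v 0%N) x).
Implicit Types (x y z : R) (k : nat).

Local Notation height := (height m n).
Local Notation b k := (~~ odd k).

(* The coordinate of [x] for the map induced at stage [k], measured from the
   right end of the previous domain. *)
Fixpoint loc k x := if k is k'.+1 then total (v k') - loc k' x else x.

Definition inJ k i x := in_piece (b k) (v k) i (loc k x).
Definition base k x := in_dom (b k) (v k) (loc k x).

Lemma inJ_base k i x : inJ k i x -> base k x.
Proof. exact: in_piece_dom. Qed.

Lemma base_inJ k x : base k x -> exists i, inJ k i x.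
Proof. by move=> /letter_at_in h; exists (letter_at (b k) (v k) (loc k x)). Qed.

Lemma inJ_uniq k i j x : inJ k i x -> inJ k j x -> i = j.
Proof.
by move=> /(in_letter_at (v0 k)) <- /(in_letter_at (v0 k)).
Qed.

Lemma inJ_L4 k x : inJ k L4 x = base k.+1 x.
Proof. exact: in_piece_L4 (vE k) _. Qed.

Lemma base_le k x : base k.+1 x -> base k x.
Proof. by rewrite -inJ_L4; exact: inJ_base. Qed.

Lemma base_base0 k x : base k x -> base 0 x.
Proof. by elim: k => // k IH /base_le. Qed.

Lemma loc_inj k : injective (loc k).
Proof. by elim: k => [|k IH] x y //= /addrI /oppr_inj /IH. Qed.

Lemma loc_surj k u : exists x, loc k x = u.
Proof.
elim: k u => [|k IH] u; first by exists u.
by have [x xE] := IH (total (v k) - u); exists x; rewrite /= xE subKr.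
Qed.

Lemma loc_dist k x y : `|loc k x - loc k y| = `|x - y|.
Proof.
elim: k x y => //= k IH x y; rewrite -(IH x y) -[RHS]normrN; congr (`| _ |); ring.
Qed.

Lemma height_gt0 k i : (0 < height k i)%N.
Proof.
elim: k i => // k IH i /=; have h := IH L4.
by rewrite /word /= addn_gt0 h.
Qed.

Definition time k w := sumn [seq height k a | a <- w].

Lemma heightS k i : height k.+1 i = time k (word (m k) (n k) i).
Proof. by []. Qed.

Lemma locS k x : loc k.+1 x = total (v k) - loc k x.
Proof. by []. Qed.

(** The first premise is [loc_return] at stage [k]; it is kept as a premise because the induction
    proving [loc_return] uses this lemma. *)
Lemma time_follows k w x :
  (forall i x, inJ k i x ->
     loc k (iter (height k i) T x) = exchange (b k) (v k) (loc k x)) ->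
  follows (b k) (v k) w (loc k x) ->
  loc k (iter (time k w) T x) = iter (size w) (exchange (b k) (v k)) (loc k x).
Proof.
move=> I1; elim: w x => // a w IH x [ha hw].
by rewrite [time _ _]addnC iterD IH ?I1// -iterSr.
Qed.

Lemma inJ_follows k i x : inJ k.+1 i x ->
  follows (b k) (v k) (word (m k) (n k) i) (loc k x).
Proof. by move=> /(follows_word (v0 k.+1) (vE k))[]. Qed.

Lemma loc_return k i x : inJ k i x ->
  loc k (iter (height k i) T x) = exchange (b k) (v k) (loc k x).
Proof.
elim: k i x => [|k IH] i x hx.
  by rewrite /= iet_map_exchange //; exact: inJ_base hx.
rewrite heightS locS time_follows//; last exact: inJ_follows.
by have [_ ->] := follows_word (v0 k.+1) (vE k) hx; rewrite subKr.
Qed.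

Lemma base_return k i x : inJ k i x -> base k (iter (height k i) T x).
Proof.
move=> hx; rewrite /base loc_return//; apply: exchange_dom => //.
exact: inJ_base hx.
Qed.

Lemma visit k i x q : inJ k.+1 i x -> (q < size (word (m k) (n k) i))%N ->
  let y := iter (time k (take q (word (m k) (n k) i))) T x in
  inJ k (nth L1 (word (m k) (n k) i) q) y /\
  loc k y = iter q (exchange (b k) (v k)) (loc k x).
Proof.
move=> /inJ_follows + qs /=; have := follows_nth (R := R) (b := b k) (l := v k).
move=> /(_ (word (m k) (n k) i) (loc k x) q) h f; have {h} := h f qs.
suff lE : loc k (iter (time k (take q (word (m k) (n k) i))) T x) =
   iter q (exchange (b k) (v k)) (loc k x) by rewrite /inJ lE.
rewrite time_follows; first by rewrite size_takel // ltnW.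
  exact: loc_return.
by move: f; rewrite -{1}(cat_take_drop q (word _ _ _)); move: (take _ _) (loc k x);
  elim=> //= a w IH u [? /IH].
Qed.

Lemma time_split k w j : (j < time k w)%N -> exists q j',
  [/\ (q < size w)%N, (j' < height k (nth L1 w q))%N &
      j = (time k (take q w) + j')%N].
Proof.
elim: w j => // a w IH j; rewrite [time _ _]/= -/(time k w).
have [ja _|aj h] := ltnP j (height k a); first by exists 0%N, j.
have [|q [j' [h1 h2 h3]]] := IH (j - height k a)%N; first by rewrite ltn_subLR.
exists q.+1, j'; split => //.
by rewrite /time /= -addnA -/(time k _) -h3 subnKC.
Qed.

Lemma word_neq4 m' n' i q : (0 < q < size (word m' n' i))%N ->
  nth L1 (word m' n' i) q <> L4.
Proof.
case: q => // q /=; rewrite ltnS.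
set w := (X in size X) => h.
suff /(all_nthP L1)/(_ q h) : all (fun a => if a is L4 then false else true) w.
  by rewrite -/w; case: nth.
by rewrite /w; case: i {w h} => /=; rewrite ?all_cat /= ?all_nseq ?orbT.
Qed.

(** At the foot of a stage-[k] tower met during the climb, the letter is not the first of the word,
    hence not [L4], and [inJ k L4] is [base k.+1]. Strictly inside such a tower the orbit is not
    even in the larger set [base k], by induction. *)
Lemma first_return k i x j : inJ k i x -> (0 < j < height k i)%N ->
  ~ base k (iter j T x).
Proof.
elim: k i x j => [|k IH] i x j hx; first by rewrite ltnS [leqRHS]/= ltnNge; case: leq.
move=> /andP[j0 jh]; have [q [j' [qs jj jE]]] := time_split jh.
have [hv _] := visit hx qs; rewrite jE addnC iterD.
have [j'0'|j'0] := posnP j'.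
  rewrite j'0' /=.
  rewrite -inJ_L4 => /(inJ_uniq hv); apply: word_neq4; rewrite qs andbT.
  rewrite lt0n; apply/eqP => q0; move: j0; rewrite jE q0 take0 /=.
  by rewrite j'0' addn0.
by move=> /base_le; apply: IH hv _; rewrite j'0.
Qed.

Lemma sweep k x : base 0 x -> exists z j, base k z /\ x = iter j T z.
Proof.
move=> hx; elim: k => [|k [z [j [hz ->]]]]; first by exists x, 0%N.
have [u0 [q [hu uE]]] := sweptP (v0 k.+1) (vE k) hz.
have [z0 z0E] := loc_surj k u0.
rewrite -z0E in hu uE; exists z0.
have H : forall p, exists j, let y := iter j T z0 in
    base k y /\ loc k y = iter p (exchange (b k) (v k)) (loc k z0).
  elim=> [|p [j' [yb yE]]]; first by exists 0%N; split => //; exact: inJ_base hu.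
  have [i hi] := base_inJ yb.
  exists (height k i + j')%N; rewrite iterD; split; first exact: base_return.
  by rewrite loc_return // yE.
have [j' [_]] := H q; rewrite -uE => /loc_inj <-.
by exists (j + j')%N; rewrite -iterD -inJ_L4.
Qed.

(** Points of one piece share their itinerary, hence their displacements. The case [j = height k i]
    is allowed: the return itself is a translation on each piece. *)
Lemma translation k i x y j : inJ k i x -> inJ k i y -> (j <= height k i)%N ->
  iter j T x - iter j T y = x - y.
Proof.
elim: k i x y j => [|k IH] i x y j hx hy.
  case: j => [//|[|//]] _ /=.
  rewrite !iet_map_exchange; [|exact: inJ_base hy|exact: inJ_base hx].
  rewrite (exchange_in (v0 0%N) hx) (exchange_in (v0 0%N) hy) /=; ring.
rewrite heightS.
move: (inJ_follows hx) (inJ_follows hy) => {hx hy}.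
elim: (word _ _ _) x y j => [|a w IHw] x y j.
  by rewrite leqn0 => _ _ /eqP ->.
move=> [hx fx] [hy fy]; rewrite /time /= -/(time k w) => jh.
have [ja|aj] := leqP j (height k a); first exact: IH hx hy ja.
rewrite -(subnK (ltnW aj)) !iterD IHw ?leq_subLR//.
- exact: IH hx hy _.
- by rewrite loc_return.
- by rewrite loc_return.
Qed.

Lemma T_base0 x : base 0 x -> base 0 (T x).
Proof. by move=> hx; have [i hi] := base_inJ hx; have := base_return hi. Qed.

Lemma iter_base0 j x : base 0 x -> base 0 (iter j T x).
Proof. by elim: j => //= j IH /IH /T_base0. Qed.

Lemma T_inj x y : base 0 x -> base 0 y -> T x = T y -> x = y.
Proof. by move=> hx hy; rewrite !iet_map_exchange//; exact: exchange_inj. Qed.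

Lemma iter_T_inj j x y : base 0 x -> base 0 y -> iter j T x = iter j T y -> x = y.
Proof.
move=> hx hy; elim: j => //= j IH /T_inj h; apply: IH; apply: h; exact: iter_base0.
Qed.

Definition tower k i x := exists z j,
  [/\ inJ k i z, (j < height k i)%N & x = iter j T z].

Lemma tower_cover k x : base 0 x -> exists i, tower k i x.
Proof.
move=> /(sweep k)[z [j [+ ->]]].
have [N] := ubnP j; elim: N z j => // N IH z j jN hz.
have [i hi] := base_inJ hz.
have [jh|hj] := ltnP j (height k i); first by exists i, z, j.
rewrite -(subnK hj) iterD; apply: IH; last exact: base_return.
have := height_gt0 k i; move: hj jN; clear; lia.
Qed.

Lemma tower_base0 k i x : tower k i x -> base 0 x.
Proof.
by move=> [z [j [hz _ ->]]]; apply: iter_base0; exact/(base_base0 (k := k))/inJ_base/hz.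
Qed.

(** Injectivity cancels the common part of the two climbs; what remains is a point of the domain met
    strictly before a first return, unless [j = j']. *)
Lemma level_uniq k i i' z z' j j' : inJ k i z -> inJ k i' z' ->
  (j < height k i)%N -> (j' < height k i')%N -> iter j T z = iter j' T z' ->
  [/\ i = i', j = j' & z = z'].
Proof.
wlog jj : i i' z z' j j' / (j <= j')%N.
  move=> H hz hz' hj hj' e; have [|/ltnW] := leqP j j'; first by move=> /H; exact.
  by move=> /H/(_ hz' hz hj' hj (esym e))[-> -> ->].
move=> hz hz' hj hj'; rewrite -{1}(subnKC jj) iterD => /iter_T_inj.
move=> /(_ (base_base0 (inJ_base hz)) (iter_base0 _ (base_base0 (inJ_base hz')))) zE.
have [j0|j0] := posnP (j' - j)%N.
  move: zE; rewrite j0 /= => zE; subst z'; split => //.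
    exact: inJ_uniq hz hz'.
  by apply/eqP; rewrite eqn_leq jj -subn_eq0 j0.
exfalso; apply: (first_return (j := j' - j) hz').
  by rewrite j0 (leq_ltn_trans _ hj') // leq_subr.
by rewrite -zE; exact: inJ_base hz.
Qed.

Lemma tower_uniq k i j x : tower k i x -> tower k j x -> i = j.
Proof.
by move=> [z [p [hz hp ->]]] [z' [p' [hz' hp' /(level_uniq hz hz' hp hp')[]]]].
Qed.

Lemma visit_time k i q : (q < size (word (m k) (n k) i))%N ->
  (time k (take q (word (m k) (n k) i)) + height k (nth L1 (word (m k) (n k) i) q)
     <= height k.+1 i)%N.
Proof.
move=> qs; rewrite heightS /time -{3}(cat_take_drop q (word _ _ _)) map_cat sumn_cat.
by rewrite leq_add2l (drop_nth L1) //= leq_addr.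
Qed.

(** One height at most is spent in reaching [base k.+1]. The next climb passes, by [visit_near],
    within [v k L4] of the foot of the orbit segment through [y], and climbing tower 3 of stage [k]
    keeps the distance by [translation]. *)
Lemma visit_tower_L3 k x y H : (forall i, (height k.+1 i <= H)%N) ->
  base 0 x -> tower k L3 y ->
  exists2 t, (t <= 2 * H)%N & base 0 (iter t T x) /\ `|iter t T x - y| <= v k L4.
Proof.
move=> hH hx [w [j' [hw jw ->]]].
have [i [z [j [hz jz xE]]]] := tower_cover k.+1 hx.
pose z2 := iter (height k.+1 i) T z.
have z2b : base k.+1 z2 by exact: base_return.
have z2E : z2 = iter (height k.+1 i - j) T x by rewrite xE -iterD subnK // ltnW.
have [i2 hz2] := base_inJ z2b.
have [q qs [q3 qd]] := visit_near (v0 k.+1) (vE k) (m0 k) (n0 k) hz2 hw.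
have [hv lv] := visit hz2 qs; have ht := visit_time qs.
set y' := iter _ T z2 in hv lv.
rewrite -lv in q3 qd.
have i3 := inJ_uniq hv (q3 : inJ k L3 y').
exists (j' + (time k (take q (word (m k) (n k) i2)) + (height k.+1 i - j)))%N.
  by move: ht; rewrite i3 => ht; have := hH i; have := hH i2; lia.
split; first exact: iter_base0.
rewrite 2!iterD -z2E -/y' (translation q3 hw (ltnW jw)).
by rewrite -(loc_dist k).
Qed.

(** Two stages up, the point lies in piece [L4] of stage [k.+1], whose word begins with [L4], [L1],
    [L3]. For [L2]: every word has [L1] or [L2] as second letter, and the words of these two have
    [L2] as second letter. *)
Lemma reach k i x : base 0 x -> exists t, inJ k i (iter t T x).
Proof.
move=> hx.
have [i0 [z [j [hz jz xE]]]] := tower_cover k.+2 hx.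
pose z2 := iter (height k.+2 i0) T z.
have z2b : base k.+2 z2 by exact: base_return.
have z2E : z2 = iter (height k.+2 i0 - j) T x by rewrite xE -iterD subnK // ltnW.
suff [t ht] : exists t, inJ k i (iter t T z2).
  by exists (t + (height k.+2 i0 - j))%N; rewrite iterD -z2E.
have [i2 hz2] := base_inJ z2b.
have step k' i' y q : inJ k'.+1 i' y -> (q < size (word (m k') (n k') i'))%N ->
    exists t, inJ k' (nth L1 (word (m k') (n k') i') q) (iter t T y).
  by move=> hy /(visit hy)[h _]; eexists; exact: h.
have nS : exists n', n k = n'.+1 by exists (n k).-1; rewrite prednK.
have mS : exists m', m k = m'.+1 by exists (m k).-1; rewrite prednK.
have mS1 : exists m', m k.+1 = m'.+1 by exists (m k.+1).-1; rewrite prednK.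
case: nS => n' nE; case: mS => m' mE; case: mS1 => m1 mE1.
have h4 : inJ k.+1 L4 z2 by rewrite inJ_L4; exact: z2b.
have [a aE [t1 h1]] : exists2 a, a = L1 \/ a = L2 & exists t, inJ k.+1 a (iter t T z2).
  have : exists2 a, a = L1 \/ a = L2 & a = nth L1 (word (m k.+1) (n k.+1) i2) 1.
    by rewrite mE1; case: (i2) => /=; eexists; [|reflexivity| |reflexivity| |reflexivity| |reflexivity]; tauto.
  move=> [a aE ae]; exists a => //; rewrite ae; apply: step hz2 _.
  by rewrite mE1; case: (i2); rewrite /= ?size_cat /= ?size_nseq.
case: i.
- by have := step _ _ _ 1%N h4; apply.
- have : nth L1 (word (m k) (n k) a) 1 = L2 by case: aE => ->; rewrite mE.
  move=> e; have [|t] := step _ _ _ 1%N h1.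
    by case: aE => ->; rewrite /= mE.
  by rewrite e -iterD => ?; exists (t + t1)%N.
- have := step _ _ _ 2 h4; rewrite /= ; apply.
  by rewrite size_nseq.
- by exists 0%N; rewrite inJ_L4; apply: base_le; exact: z2b.
Qed.

Lemma dense_orbits k x y : base 0 x -> base 0 y ->
  exists t, base 0 (iter t T x) /\ `|iter t T x - y| < total (v k).
Proof.
move=> hx /(tower_cover k)[i [w [j [hw jh ->]]]].
have [t ht] := reach k i hx.
exists (j + t)%N; split; first exact: iter_base0.
rewrite iterD (translation ht hw (ltnW jh)) -(loc_dist k).
move: ht hw => /inJ_base + /inJ_base; rewrite /base /in_dom => /andP[+ +] /andP[].
set B := ~~ odd k; rewrite ltr_norml; case: B => /= *; lra.
Qed.

(** * Levels of the towers as intervals of the original line *)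

Fixpoint origin k : R := if k is k'.+1 then
    if odd k' then origin k' - total (v k') else origin k' + total (v k') else 0.

Lemma locE k x : loc k x = if odd k then origin k - x else x - origin k.
Proof.
elim: k => [|k IH] /=; first by rewrite subr0.
by rewrite IH; case: (odd k) => /=; ring.
Qed.

Definition left_end k i : R :=
  if odd k then origin k - cut (v k) i - v k i else origin k + cut (v k) i.

(** At odd stages the reflected coordinate and the exchanged end points compensate each other, so at
    every stage the pieces are closed on the left and open on the right in the original line. *)
Lemma inJ_left k i x : inJ k i x = (left_end k i <= x < left_end k i + v k i).
Proof.
rewrite /inJ /in_piece locE /left_end; case: (odd k) => /=; first rewrite andbC;
  by congr andb; apply/idP/idP; lra.
Qed.

Lemma inJ_left_end k i : inJ k i (left_end k i).
Proof. by rewrite inJ_left lexx ltrDl v0. Qed.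

Definition level_end k i j := iter j T (left_end k i).

Lemma levelP k i j x : (j < height k i)%N ->
  (exists2 z, inJ k i z & x = iter j T z) <->
  level_end k i j <= x < level_end k i j + v k i.
Proof.
move=> jh; have tr z hz := translation (x := z) hz (inJ_left_end k i) (ltnW jh).
split.
  move=> [z hz ->]; have := tr z hz; rewrite -/(level_end k i j).
  by move: hz; rewrite inJ_left => /andP[h1 h2] h3; apply/andP; split; lra.
move=> /andP[h1 h2]; pose z := left_end k i + (x - level_end k i j).
have hz : inJ k i z by rewrite inJ_left /z; apply/andP; split; lra.
exists z => //; have := tr z hz; rewrite -/(level_end k i j) /z; lra.
Qed.

Lemma towerP k i x : tower k i x <-> exists2 j, (j < height k i)%N &
  level_end k i j <= x < level_end k i j + v k i.
Proof.
split=> [[z [j [hz jh xE]]]|[j jh /(levelP _ jh)[z hz xE]]].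
  by exists j => //; apply/levelP => //; exists z.
by exists z, j.
Qed.

(** For the word of a tower of stage [k.+1], the [j]-th entry names the stage-[k] tower that
    contains its [j]-th level; the mass of an intersection of towers becomes a count of letters. *)
Definition expand k w := flatten [seq nseq (height k a) a | a <- w].

Lemma nth_expand k w q j : (q < size w)%N -> (j < height k (nth L1 w q))%N ->
  nth L1 (expand k w) (time k (take q w) + j) = nth L1 w q.
Proof.
elim: w q => // a w IH [|q] /= qs jh.
  by rewrite /expand /= add0n nth_cat size_nseq jh nth_nseq jh.
rewrite /expand /= nth_cat size_nseq /time /= -addnA ltnNge leq_addr /= addKn.
exact: IH.
Qed.

Lemma size_expand k w : size (expand k w) = time k w.
Proof. by elim: w => //= a w IH; rewrite /expand /= size_cat size_nseq IH. Qed.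

Lemma count_expand k w (P : pred letter) :
  count P (expand k w) = sumn [seq height k a | a <- w & P a].
Proof.
elim: w => //= a w IH; rewrite /expand /= count_cat count_nseq IH.
by case: (P a); rewrite ?mul1n ?mul0n.
Qed.

Lemma tower_meet k i a x : tower k.+1 i x -> tower k a x ->
  exists2 j, (j < height k.+1 i)%N &
    nth L1 (expand k (word (m k) (n k) i)) j = a /\
    level_end k.+1 i j <= x < level_end k.+1 i j + v k.+1 i.
Proof.
move=> [z [j [hz jh xE]]] ha; exists j => //; split; last by apply/levelP => //; exists z.
have [q [j' [qs jq jE]]] := time_split jh.
have [hv _] := visit hz qs.
rewrite jE nth_expand //.
suff : tower k (nth L1 (word (m k) (n k) i) q) x by move=> /tower_uniq; apply.
by exists (iter (time k (take q (word (m k) (n k) i))) T z), j'; rewrite xE jE addnC iterD.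
Qed.

End Tower.

(** * Existence of the lengths *)

Lemma fmap_ultra (S U : Type) (f : S -> U) (F : set_system S) :
  UltraFilter F -> UltraFilter (f @ F).
Proof.
move=> FU; have FF := @ultra_proper _ _ FU; split; first exact: fmap_proper_filter.
move=> G GG sFG; apply/seteqP; split => A GA; last exact: sFG.
have [//|FnA] := in_ultra_setVsetC (f @^-1` A) FU.
have GnA : G (~` A) by apply: sFG.
have : G (A `&` ~` A) by apply: filterI.
by rewrite setICr => /filter_ex[].
Qed.

Section HeightBounds.
Variables (m n : nat -> nat).
Local Notation h := (height m n).

Lemma height1 k : h k.+1 L1 = (h k L4 + m k * h k L2 + (n k).+1 * h k L3)%N.
Proof.
by rewrite /= map_cat sumn_cat /= !map_nseq !sumn_nseq; lia.
Qed.

Lemma height2 k : h k.+1 L2 = (h k L4 + (m k).+1 * h k L2 + (n k).+1 * h k L3)%N.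
Proof. by rewrite /= map_cat sumn_cat /= !map_nseq !sumn_nseq; lia. Qed.

Lemma height3 k : h k.+1 L3 = (h k L4 + h k L1 + n k * h k L3)%N.
Proof. by rewrite /= map_nseq sumn_nseq; lia. Qed.

Lemma height4 k : h k.+1 L4 = (h k L4 + h k L1 + (n k).+1 * h k L3)%N.
Proof. by rewrite /= map_nseq sumn_nseq; lia. Qed.

End HeightBounds.

Section Lengths.
Variables (R : realType) (m n : nat -> nat).
Local Notation h := (height m n).
Implicit Types (v : letter -> R).

Definition mass12 k v := (h k L1)%:R * v L1 + (h k L2)%:R * v L2.
Definition mass34 k v := (h k L3)%:R * v L3 + (h k L4)%:R * v L4.

(** Heights are transformed by the transpose of the matrix that [keane] applies to lengths, so the
    pairing of the two vectors is conserved. *)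
Lemma mass_keane k v : mass12 k (keane (m k) (n k) v) + mass34 k (keane (m k) (n k) v)
  = mass12 k.+1 v + mass34 k.+1 v.
Proof.
rewrite /mass12 /mass34 height1 height2 height3 height4 /= /total.
by rewrite !natrD !natrM -!natr1; ring.
Qed.

(** The words of [L3] and [L4] contain exactly one letter among [L1] and [L2], namely one [L1]; [e]
    bounds its share of the new height. *)
Lemma mass12_keane k v (e : R) : (forall i, 0 <= v i) ->
  (h k L1)%:R <= e * (h k.+1 L3)%:R -> (h k L1)%:R <= e * (h k.+1 L4)%:R ->
  mass12 k (keane (m k) (n k) v) <= mass12 k.+1 v + e * mass34 k.+1 v.
Proof.
move=> v0 h3 h4; rewrite -subr_ge0.
set E := (X in 0 <= X).
have -> : E = (e * (h k.+1 L3)%:R - (h k L1)%:R) * v L3 +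
   (e * (h k.+1 L4)%:R - (h k L1)%:R) * v L4 +
   ((h k L4)%:R + (n k).+1%:R * (h k L3)%:R) * (v L1 + v L2).
  rewrite /E /mass12 /mass34 height1 height2 /= /total.
  by rewrite !natrD !natrM -!natr1; ring.
by rewrite !addr_ge0 // mulr_ge0 ?subr_ge0 ?addr_ge0 ?mulr_ge0.
Qed.

(** The words of [L1] and [L2] contain one [L4] and [n.+1] letters [L3]; [e] bounds their share of
    the new height. *)
Lemma mass34_keane k v (e : R) : (forall i, 0 <= v i) ->
  (h k L4)%:R + (n k).+1%:R * (h k L3)%:R <= e * (h k.+1 L1)%:R ->
  (h k L4)%:R + (n k).+1%:R * (h k L3)%:R <= e * (h k.+1 L2)%:R ->
  mass34 k (keane (m k) (n k) v) <= mass34 k.+1 v + e * mass12 k.+1 v.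
Proof.
move=> v0 h3 h4; rewrite -subr_ge0.
set E := (X in 0 <= X).
have -> : E = (e * (h k.+1 L1)%:R - ((h k L4)%:R + (n k).+1%:R * (h k L3)%:R)) * v L1 +
   (e * (h k.+1 L2)%:R - ((h k L4)%:R + (n k).+1%:R * (h k L3)%:R)) * v L2 +
   (h k L1)%:R * (v L3 + v L4).
  rewrite /E /mass12 /mass34 height3 height4 /= /total.
  by rewrite !natrD !natrM -!natr1; ring.
by rewrite !addr_ge0 // mulr_ge0 ?subr_ge0 ?addr_ge0 ?mulr_ge0.
Qed.

Section Limit.
Variable e : nat -> R.
Hypotheses (hS : forall k i, i = L3 \/ i = L4 -> (h k L1)%:R <= e k * (h k.+1 i)%:R)
  (hU : forall k i, i = L1 \/ i = L2 ->
     (h k L4)%:R + (n k).+1%:R * (h k L3)%:R <= e k * (h k.+1 i)%:R).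
Variable c : nat -> R.
Hypotheses (c12 : forall k, 2^-1 <= c k) (ec : forall k, c k.+1 + e k <= c k).
Hypotheses (m0 : forall k, (0 < m k)%N) (n0 : forall k, (0 < n k)%N).

Let e0 k : 0 <= e k.
Proof.
have := hS k (or_introl erefl).
rewrite -ler_pdivrMr; last by rewrite ltr0n height_gt0.
by apply: le_trans; rewrite divr_ge0.
Qed.

(* At stage [K] the second and third towers have measure 1/2 each; pulling this
   back to stage 0 and letting [K] tend to infinity along an ultrafilter gives
   the lengths. *)
Fixpoint backward K d : letter -> R :=
  if d is d'.+1 then keane (m (K - d)) (n (K - d)) (backward K d')
  else fun i => match i with
    | L2 => (2 * (h K L2)%:R)^-1 | L3 => (2 * (h K L3)%:R)^-1 | _ => 0 end.

Definition approx K k := backward K (K - k).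

Lemma approx_keane K k : (k < K)%N -> approx K k = keane (m k) (n k) (approx K k.+1).
Proof.
move=> kK; rewrite /approx; have -> : (K - k = (K - k.+1).+1)%N by lia.
by rewrite /= (_ : K - _ = k)%N //; lia.
Qed.

Lemma keane_ge0 m' n' v : (forall i, 0 <= v i) -> forall i, 0 <= keane m' n' v i.
Proof.
by move=> v0; case; rewrite /= /total ?addr_ge0 ?mulr_ge0 ?addr_ge0.
Qed.

(** Both masses are 1/2 at stage [K]. As they add up to 1, each grows by at most [e k] when going
    down from stage [k.+1] to stage [k], which the decrease of [c] absorbs. *)
Lemma approxP K k : (k <= K)%N ->
  [/\ forall i, 0 <= approx K k i,
      mass12 k (approx K k) + mass34 k (approx K k) = 1,
      mass12 k (approx K k) <= c k & mass34 k (approx K k) <= c k].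
Proof.
move=> kK; rewrite -(subKn kK); move: (K - k)%N (leq_subr k K) => d.
elim: d => [_|d IH dK].
  rewrite subn0 /approx subnn /mass12 /mass34 /= !mulr0 add0r addr0.
  have H i : (h K i)%:R / (2 * (h K i)%:R) = 2^-1 :> R.
    by rewrite invfM mulrA mulrAC divff ?mul1r // pnatr_eq0 -lt0n height_gt0.
  rewrite !H; split=> //; last by lra.
  by case=> //=; rewrite invr_ge0 mulr_ge0.
have [v0 v1 vS vU] := IH (ltnW dK).
have E : (K - d = (K - d.+1).+1)%N by lia.
rewrite E in v0 v1 vS vU; set k' := (K - d.+1)%N in v0 v1 vS vU *.
rewrite (@approx_keane K k'); last by rewrite /k'; lia.
set w := approx K k'.+1 in v0 v1 vS vU *.
have S0 : 0 <= mass12 k'.+1 w by rewrite /mass12 addr_ge0 // mulr_ge0.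
have U0 : 0 <= mass34 k'.+1 w by rewrite /mass34 addr_ge0 // mulr_ge0.
split; first exact: keane_ge0.
- by rewrite mass_keane.
- apply: le_trans (mass12_keane v0 (hS _ (or_introl erefl)) (hS _ (or_intror erefl))) _.
  apply: le_trans (ec k'); apply: lerD => //.
  by rewrite ler_piMr // -v1 lerDr.
- apply: le_trans (mass34_keane v0 (hU _ (or_introl erefl)) (hU _ (or_intror erefl))) _.
  apply: le_trans (ec k'); apply: lerD => //.
  by rewrite ler_piMr // -v1 lerDl.
Qed.

Lemma approx_le1 K k i : 0 <= approx K k i <= 1.
Proof.
(* For [K < k] the truncated subtraction makes [approx K k] the starting vector of stage [K]. *)
have [kK|Kk] := leqP k K; last first.
  rewrite /approx (_ : K - k = 0)%N; last by lia.
  have H j : 1 <= 2 * (h K j)%:R :> R.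
    have : 1 <= (h K j)%:R :> R by rewrite ler1n height_gt0.
    lra.
  by case: i => /=; rewrite ?lexx ?ler01 // invr_ge0 mulr_ge0 //= invf_le1 ?H// (lt_le_trans ltr01).
have [v0 v1 _ _] := approxP kK; rewrite v0 /=.
rewrite -v1 /mass12 /mass34.
have H j : approx K k j <= (h k j)%:R * approx K k j.
  by rewrite ler_peMl // ler1n height_gt0.
have H0 j : 0 <= (h k j)%:R * approx K k j by rewrite mulr_ge0.
case: i.
- have := (H L1, H0 L2, H0 L3, H0 L4); move=> [[[? ?] ?] ?]; lra.
- have := (H L2, H0 L1, H0 L3, H0 L4); move=> [[[? ?] ?] ?]; lra.
- have := (H L3, H0 L1, H0 L2, H0 L4); move=> [[[? ?] ?] ?]; lra.
- have := (H L4, H0 L1, H0 L2, H0 L3); move=> [[[? ?] ?] ?]; lra.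
Qed.

Lemma lengths_exist : exists v : nat -> letter -> R,
  [/\ forall k i, 0 < v k i,
      forall k i, v k i = keane (m k) (n k) (v k.+1) i,
      forall k, mass12 k (v k) + mass34 k (v k) = 1,
      forall k, mass12 k (v k) <= c k & forall k, mass34 k (v k) <= c k].
Proof.
have [U [UU Uoo]] := @ultraFilterLemma nat \oo _.
have UP := @ultra_proper _ _ UU.
have lim k i : exists l : R, (fun K => approx K k i) @ U --> l.
  have := @segment_compact R 0 1; rewrite compact_ultra.
  move=> /(_ _ (fmap_ultra (fun K => approx K k i) UU)).
  case; last by move=> l [_ ?]; exists l.
  suff : U [set K | approx K k i \in `[0, 1]] by [].
  by apply: filterE => K; rewrite /= in_itv /=; exact: approx_le1.
have /choice[v vlim] : forall k, exists vk : letter -> R,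
    forall i, (fun K => approx K k i) @ U --> vk i.
  by move=> k; have /choice[vk h] := lim k; exists vk.
exists v.
have ev k : \forall K \near U, (k < K)%N.
  by apply: Uoo; exists k.+1.
have limS k : (fun K => mass12 k (approx K k)) @ U --> mass12 k (v k).
  by apply: cvgD; apply: cvgM; (exact: cvg_cst || exact: vlim).
have limU k : (fun K => mass34 k (approx K k)) @ U --> mass34 k (v k).
  by apply: cvgD; apply: cvgM; (exact: cvg_cst || exact: vlim).
have v_ge0 k i : 0 <= v k i.
  refine (closed_cvg (fun x : R => 0 <= x) _ _ _ (vlim k i)); first exact: closed_ge.
  by apply: nearW => K; have /andP[] := approx_le1 K k i.
have vE k i : v k i = keane (m k) (n k) (v k.+1) i.
  have : (fun K => keane (m k) (n k) (approx K k.+1) i) @ U -->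
      keane (m k) (n k) (v k.+1) i.
    have M a j : (fun K => a * approx K k.+1 j) @ U --> a * v k.+1 j.
      by apply: cvgM; (exact: cvg_cst || exact: vlim).
    case: i; rewrite /keane /total.
    - by apply: cvgD.
    - by apply: cvgD.
    - apply: cvgD => //; apply: cvgM; first exact: cvg_cst.
      by apply: cvgD => //; apply: cvgD.
    - by apply: cvgD => //; apply: cvgD => //; apply: cvgD.
  move=> cv1.
  have cv2 : (fun K => keane (m k) (n k) (approx K k.+1) i) @ U --> v k i.
    apply: cvg_trans (vlim k i); apply: near_eq_cvg.
    by near=> K; rewrite (@approx_keane K k) //; near: K; exact: ev.
  have e2 := cvg_lim (@norm_hausdorff _ R) cv2. have e1 := cvg_lim (@norm_hausdorff _ R) cv1.
  by rewrite -e2 e1.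
have mass1 k : mass12 k (v k) + mass34 k (v k) = 1.
  have H : (fun K => mass12 k (approx K k) + mass34 k (approx K k)) @ U -->
      mass12 k (v k) + mass34 k (v k) by apply: cvgD.
  have H1 : (fun K => mass12 k (approx K k) + mass34 k (approx K k)) @ U --> (1 : R).
    apply: cvg_near_cst; by near=> K; have [|_ ->] := @approxP K k => //; apply/ltnW; near: K; exact: ev.
  have e2 := cvg_lim (@norm_hausdorff _ R) H. have e1 := cvg_lim (@norm_hausdorff _ R) H1.
  by rewrite -e2 e1.
split => //.
(* The limit gives only nonnegative lengths. The vector of stage [k.+2] is nonzero because its mass
   is 1, and two applications of [keane] make a nonzero vector positive. *)
- move=> k i.
  have [j vj] : exists j, 0 < v k.+2 j.
    have := mass1 k.+2; rewrite /mass12 /mass34 => M.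
    apply: contrapT => /forallNP N.
    have Z j : v k.+2 j = 0 by apply/eqP; rewrite eq_le v_ge0 andbT leNgt; exact/negP.
    by move: M; rewrite !Z !mulr0 !addr0; lra.
  have pos4 : 0 < v k.+1 L4.
    rewrite vE /= /total; have := v_ge0 k.+2.
    by move=> z; have := (z L1, z L2, z L3, z L4) => -[[[? ?] ?] ?]; case: j vj => ?; lra.
  have pos12 : 0 < v k.+1 L1 + v k.+1 L2.
    rewrite !vE /= ; have z := v_ge0 k.+2.
    have m1 : 1 <= (m k.+1)%:R :> R by rewrite ler1n.
    have P a j' : 1 <= a -> v k.+2 j' <= a * v k.+2 j' by move=> a1; rewrite ler_peMl.
    have := P _ L1 m1; have := P (m k.+1).+1%:R L2; rewrite ler1n => /(_ isT).
    by have := (z L1, z L2, z L3, z L4) => -[[[? ?] ?] ?] ? ?; case: j vj => ?; lra.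
  have z := v_ge0 k.+1; have := (z L1, z L2, z L3) => -[[? ?] ?].
  have P a j' : 1 <= a -> v k.+1 j' <= a * v k.+1 j' by move=> a1; rewrite ler_peMl.
  have m1 : 1 <= (m k)%:R :> R by rewrite ler1n.
  rewrite vE; case: i => /=.
  + lra.
  + have := P _ L1 m1; have := P (m k).+1%:R L2; rewrite ler1n => /(_ isT).
    lra.
  + rewrite ltr_wpDr ?mulr_ge0// mulr_gt0//; lra.
  + rewrite /total; lra.
- move=> k; refine (closed_cvg (fun x : R => x <= c k) _ _ _ (limS k)); first exact: closed_le.
  by near=> K; have [|_ _ ? _] := @approxP K k => //; apply/ltnW; near: K; exact: ev.
- move=> k; refine (closed_cvg (fun x : R => x <= c k) _ _ _ (limU k)); first exact: closed_le.
  by near=> K; have [|_ _ _ ?] := @approxP K k => //; apply/ltnW; near: K; exact: ev.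
Unshelve. all: by end_near.
Qed.

End Limit.
End Lengths.

(** * Choice of the parameters *)

(* The parameter [kn k] is a huge power of the heights of stage [k], while
   [km k / kn k] only grows geometrically; [hseq] computes the heights and the
   parameters simultaneously. *)
Definition scale k h : nat := (2 ^ (k + 6) * h)%N.

Fixpoint hseq k : letter -> nat :=
  if k is k'.+1 then
    let n := (scale k' (hseq k' L2) ^ (k' + 6))%N in
    fun i => sumn [seq hseq k' a | a <- word (2 ^ (k' + 6) * n) n i]
  else fun=> 1%N.

Definition gap k := scale k (hseq k L2).
Local Notation Q := gap.
Definition kn k : nat := (Q k ^ (k + 6))%N.
Definition km k : nat := (2 ^ (k + 6) * kn k)%N.
Local Notation h := (height km kn).

Lemma hseqE k : hseq k = h k.
Proof. by elim: k => // k IH; apply/funext => i; rewrite /= -IH. Qed.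

Lemma gapE k : Q k = (2 ^ (k + 6) * h k L2)%N. Proof. by rewrite /Q hseqE. Qed.

Lemma gap_ge k : (2 ^ (k + 6) <= Q k)%N.
Proof. by rewrite gapE leq_pmulr // height_gt0. Qed.

Lemma height_le_gap k : (h k L2 <= Q k)%N.
Proof. by rewrite gapE leq_pmull // expn_gt0. Qed.

Lemma gap_gt0 k : (0 < Q k)%N.
Proof. by apply: leq_trans (gap_ge k); rewrite expn_gt0. Qed.

Lemma kn_gt0 k : (0 < kn k)%N.
Proof. by rewrite expn_gt0 gap_gt0. Qed.

Lemma km_gt0 k : (0 < km k)%N.
Proof. by rewrite muln_gt0 expn_gt0 kn_gt0. Qed.

Lemma kn_le_km k : (kn k <= km k)%N.
Proof. by rewrite leq_pmull // expn_gt0. Qed.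

Lemma height_order k : [/\ (h k L1 <= h k L2)%N, (h k L4 <= h k L2)%N & (h k L3 <= h k L4)%N].
Proof.
elim: k => // k [h12 h42 h34]; rewrite height1 height2 height3 height4.
have m0 := km_gt0 k; have h3 := leq_trans h34 h42.
split.
- by rewrite leq_add2r leq_add2l leq_mul2r leqnSn orbT.
- by rewrite leq_add2r leq_add2l (leq_trans h12) // leq_pmull.
- by rewrite leq_add2l leq_mul2r leqnSn orbT.
Qed.

Lemma height_le_L2 k i : (h k i <= h k L2)%N.
Proof.
by have [h12 h42 h34] := height_order k; case: i => //; exact: leq_trans h42.
Qed.

Lemma kn_le_height k i : (kn k <= h k.+1 i)%N.
Proof.
have P a j : (a <= a * h k j)%N by rewrite leq_pmulr // height_gt0.
have kmn := kn_le_km k.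
case: i; rewrite ?height1 ?height2 ?height3 ?height4.
- by have := P (km k) L2; lia.
- by have := P (km k).+1 L2; lia.
- by have := P (kn k) L3; lia.
- by have := P (kn k).+1 L3; lia.
Qed.

(** Of the at least six factors [Q k], one is spent on the height. Of the other five, four will pay
    for a union over [Q k ^ 4] times and one for a geometric series. *)
Lemma kn_ge k : (h k L2 * Q k ^ 5 <= kn k)%N.
Proof.
apply: (@leq_trans (Q k ^ 6)).
  by rewrite expnS leq_mul2r height_le_gap orbT.
by rewrite /kn leq_pexp2l ?gap_gt0 // leq_addl.
Qed.

(** The ratio of [km k] to [kn k] enters here: the bracket is at most [4 * (kn k * h k L2)], which
    uses up two of the [k + 6] powers of 2. *)
Lemma height_U k i : i = L1 \/ i = L2 ->
  (2 ^ (k + 4) * (h k L4 + (kn k).+1 * h k L3) <= h k.+1 i)%N.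
Proof.
move=> iE; apply: (@leq_trans (km k * h k L2)); last first.
  by case: iE => ->; rewrite ?height1 ?height2; lia.
have -> : (km k * h k L2 = 2 ^ (k + 4) * (4 * (kn k * h k L2)))%N.
  rewrite /km (_ : (k + 6 = k + 4 + 2)%N); last by rewrite -addnA.
  by rewrite [(2 ^ (k + 4 + 2))%N]expnD (_ : 2 ^ 2 = 4)%N // !mulnA.
rewrite leq_mul2l; apply/orP; right.
have n0 := kn_gt0 k; have h3 := height_le_L2 k L3; have h4 := height_le_L2 k L4.
apply: (@leq_trans (h k L2 + (kn k).+1 * h k L2)).
  by apply: leq_add => //; rewrite leq_mul2l h3 orbT.
have : (h k L2 <= kn k * h k L2)%N by rewrite leq_pmull.
lia.
Qed.

(** The factor [2 ^ (k + 6)] in [Q k] makes [Q k * kn k] equal to [km k * h k L2]; the three terms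
    of the height are at most 1, 2 and 2 times this product. *)
Lemma height2_le k : (h k.+1 L2 <= 5 * Q k * kn k)%N.
Proof.
have n0 := kn_gt0 k; have h3 := height_le_L2 k L3; have h4 := height_le_L2 k L4.
have kmn := kn_le_km k.
have -> : (5 * Q k * kn k = 5 * (km k * h k L2))%N by rewrite gapE /km; ring.
rewrite height2.
have : ((kn k).+1 * h k L3 <= (km k).+1 * h k L2)%N by rewrite leq_mul.
have : (h k L2 <= km k * h k L2)%N by rewrite leq_pmull // km_gt0.
lia.
Qed.

Lemma height_gt k i : (k < h k i)%N.
Proof.
elim: k i => // k IH i; have h4 := IH L4; have h1 := IH L1; have h2 := IH L2.
have P a j : (0 < a)%N -> (h k j <= a * h k j)%N by move=> ?; rewrite leq_pmull.
have := P _ L2 (km_gt0 k); have := P (km k).+1 L2 isT.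
by case: i; rewrite ?height1 ?height2 ?height3 ?height4; lia.
Qed.

Lemma gap_le k j : (k <= j)%N -> (Q k <= Q j)%N.
Proof.
elim: j => [|j IH]; first by rewrite leqn0 => /eqP ->.
rewrite leq_eqVlt => /predU1P[->//|]; rewrite ltnS => /IH /leq_trans; apply.
rewrite !gapE addSn expnS; apply: leq_mul; first by rewrite leq_pmull.
rewrite height2; have := km_gt0 j; have : (h j L2 <= (km j).+1 * h j L2)%N by rewrite leq_pmull.
lia.
Qed.

Lemma keane_lengths (R : realType) : exists v : nat -> letter -> R,
  [/\ forall k i, 0 < v k i,
      forall k i, v k i = keane (km k) (kn k) (v k.+1) i,
      forall k, mass12 km kn k (v k) + mass34 km kn k (v k) = 1,
      forall k, mass12 km kn k (v k) <= 5 / 8 & forall k, mass34 km kn k (v k) <= 5 / 8].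
Proof.
pose e k : R := (2 ^+ (k + 4))^-1.
have e0 k : 0 <= e k by rewrite invr_ge0 exprn_ge0.
have div (a c d : nat) k : (d * a <= c)%N -> (2 ^ (k + 4) <= d)%N -> a%:R <= e k * c%:R :> R.
  move=> dac d4; rewrite /e mulrC ler_pdivlMr ?exprn_gt0 // -natrX -natrM ler_nat.
  by rewrite mulnC; apply: leq_trans dac; rewrite leq_mul2r d4 orbT.
have hS k i : i = L3 \/ i = L4 -> (h k L1)%:R <= e k * (h k.+1 i)%:R.
  move=> _; apply: (div _ _ (Q k ^ 5)%N).
    apply: leq_trans (kn_le_height k i); apply: leq_trans (kn_ge k).
    by rewrite mulnC leq_mul2r height_le_L2 orbT.
  apply: (@leq_trans (Q k)).
    by apply: leq_trans (gap_ge k); rewrite leq_pexp2l // leq_add2l.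
  by rewrite -{1}(expn1 (Q k)) leq_pexp2l // gap_gt0.
have hU k i : i = L1 \/ i = L2 ->
     (h k L4)%:R + (kn k).+1%:R * (h k L3)%:R <= e k * (h k.+1 i)%:R.
  move=> iE; rewrite -natrM -natrD; apply: (div _ _ (2 ^ (k + 4))%N) => //.
  exact: height_U.
(* [2 * e k] is the sum of all [e j] with [j >= k], the total growth still to come below the limit;
   for [k = 0] it is 2/16, whence the bound 5/8. *)
pose c k : R := 2^-1 + 2 * e k.
have c12 k : 2^-1 <= c k by rewrite /c lerDl mulr_ge0.
have eS k : e k = 2 * e k.+1.
  by rewrite /e addSn exprS invfM mulrA divff ?mul1r // pnatr_eq0.
have ec k : c k.+1 + e k <= c k by rewrite /c (eS k); lra.
have c58 k : c k <= 5 / 8.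
  have : e k <= 16^-1.
    elim: k => [|k]; first by rewrite /e; lra.
    by rewrite (eS k); have := e0 k.+1; lra.
  by rewrite /c; lra.
have [v [v0 vE v1 vS vU]] := lengths_exist hS hU c12 ec km_gt0.
by exists v; split => // k; [exact: le_trans (vS k) (c58 k)|exact: le_trans (vU k) (c58 k)].
Qed.

(** * Lebesgue measure *)

Section MeasureFacts.
Variable R : realType.
Implicit Types (A B : set (measurableTypeR R)).
Local Notation mu := (@lebesgue_measure R).

Lemma lebesgue_co (a c : R) : 0 <= c -> mu `[a, a + c[%classic = c%:E.
Proof.
move=> c0; rewrite lebesgue_measure_itv /= lte_fin ltrDl.
case: ltP => [_|c0']; first by rewrite -EFinB [a + c]addrC addrK.
by congr EFin; apply/eqP; rewrite eq_le c0 c0'.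
Qed.

Lemma lebesgue_shift (c : R) A : measurable A -> mu ((fun x => x + c) @^-1` A) = mu A.
Proof.
have mf : measurable_fun [set: measurableTypeR R] ((fun x => x + c) : measurableTypeR R -> measurableTypeR R).
  by apply: measurable_funD; [exact: measurable_id|exact: measurable_cst].
move=> mA; rewrite -[LHS]/(pushforward mu _ A); symmetry.
apply: (@lebesgue_measure_unique R (pushforward mu _)) => //= _ [[a b] _ <-] /=.
rewrite /pushforward /= (_ : _ @^-1` _ = `]a - c, b - c]%classic); last first.
  by apply/seteqP; split => x /=; rewrite !in_itv /= => /andP[? ?]; apply/andP; split; lra.
rewrite !lebesgue_measure_itv /= !lte_fin ltrD2r; case: ifP => // _.
by rewrite -!EFinB; congr EFin; ring.
Qed.

Section Tail.
Context d (S : measurableType d) (nu : {measure set S -> \bar R}).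

Lemma measure_tail_le (e : R) (F : nat -> set S) (A : set S) : 0 <= e ->
  measurable A -> (forall i, measurable (F i)) ->
  (forall i, (nu (F i) <= (e / (2 ^ i.+1)%:R)%:E)%E) -> A `<=` \bigcup_i F i ->
  (nu A <= e%:E)%E.
Proof.
move=> e0 mA mF hF sA; apply: le_trans (measure_sigma_subadditive nu mF mA sA) _.
apply: le_trans (epsilon_trick0 xpredT e0).
by apply: lee_nneseries => // i _; exact: hF.
Qed.

Lemma measure_sub_le (e : \bar R) (A B : set S) : measurable A -> measurable B ->
  A `<=` B -> (nu B <= e)%E -> (nu A <= e)%E.
Proof. by move=> mA mB AB; apply: le_trans; apply: le_measure; rewrite ?inE. Qed.

Lemma measureU_le (a b : R) (A B : set S) : measurable A -> measurable B ->
  (nu A <= a%:E)%E -> (nu B <= b%:E)%E -> (nu (A `|` B) <= (a + b)%:E)%E.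
Proof.
by move=> mA mB hA hB; apply: le_trans (measureU2 _ mA mB) _; rewrite EFinD leeD.
Qed.

Lemma measure_union_le (N : nat) (P : pred nat) (F : nat -> set S) (A : set S) (w : R) :
  0 <= w -> measurable A -> (forall j, measurable (F j)) ->
  (forall j, (nu (F j) <= w%:E)%E) ->
  (forall x, A x -> exists2 j, (j < N)%N & P j /\ F j x) ->
  (nu A <= ((count P (iota 0 N))%:R * w)%:E)%E.
Proof.
move=> w0 mA mF hF sA; pose G j := if P j then F j else set0.
have mG j : measurable (G j) by rewrite /G; case: ifP.
apply: (@le_trans _ _ (nu (\big[setU/set0]_(j < N) G j))).
  apply: le_measure; rewrite ?inE //; first exact: bigsetU_measurable.
  move=> x /sA[j jN [Pj Fx]]; rewrite -bigcup_mkord; exists j => //.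
  by rewrite /G Pj.
apply: le_trans; first by apply: Boole_inequality => j _; exact: mG.
apply: (@le_trans _ _ (\sum_(j < N) ((P j)%:R * w)%:E)).
  apply: lee_sum => j _; rewrite /G; case: (P j); first by rewrite mul1r; exact: hF.
  by rewrite measure0 mul0r.
rewrite sumEFin lee_fin -mulr_suml ler_wpM2r //.
rewrite -(big_mkord xpredT (fun j => (P j)%:R : R)) /index_iota subn0.
by elim: (iota 0 N) => [|j s IH]; rewrite ?big_nil // big_cons /= natrD lerD2l.
Qed.

End Tail.

End MeasureFacts.

(** * The exchange as a transformation preserving Lebesgue measure *)

Section Preserve.
Variable R : realType.
Local Notation mu := (@lebesgue_measure R).
Implicit Types (A : set (measurableTypeR R)).

Definition iet_map (l : letter -> R) (x : R) :=
  if in_dom true l x then exchange true l x else x.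

Variable l : letter -> R.
Hypothesis l0 : forall i, 0 < l i.
Local Notation T := (iet_map l).

Let D i : set (measurableTypeR R) := [set x | in_piece true l i x].
Let E i : set (measurableTypeR R) := [set x | in_piece true l i (x - shift_by l i)].
Let D0 : set (measurableTypeR R) := [set x | in_dom true l x].

Let DE i : D i = `[cut l i, cut l i + l i[%classic.
Proof. by apply/seteqP; split => x /=; rewrite in_itv /= /D /in_piece /=. Qed.
Let EE i : E i = `[cut l i + shift_by l i, cut l i + shift_by l i + l i[%classic.
Proof.
by apply/seteqP; split => x /=; rewrite in_itv /= /E /in_piece /= => /andP[? ?];
  apply/andP; split; lra.
Qed.
Let mD i : measurable (D i). Proof. by rewrite DE; exact: measurable_itv. Qed.
Let mE i : measurable (E i). Proof. by rewrite EE; exact: measurable_itv. Qed.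
Let D0E : D0 = `[0, total l[%classic.
Proof. by apply/seteqP; split => x /=; rewrite in_itv /= /D0 /in_dom /=. Qed.
Let mD0 : measurable D0. Proof. by rewrite D0E; exact: measurable_itv. Qed.

Let T_in i x : D i x -> T x = x + shift_by l i.
Proof. by move=> hx; rewrite /T (in_piece_dom l0 hx) (exchange_in l0 hx). Qed.

Let D_uniq i j x : D i x -> D j x -> i = j.
Proof. by move=> /(in_letter_at l0) <- /(in_letter_at l0). Qed.

Let D0_cover x : D0 x -> exists i, D i x.
Proof. by move=> /letter_at_in h; exists (letter_at true l x). Qed.

Let D_D0 i : D i `<=` D0. Proof. by move=> x; exact: in_piece_dom. Qed.

Let E_cover x : D0 x -> exists i, E i x.
Proof.
rewrite /D0 /E /in_dom /in_piece /total /= => /andP[x0 x1].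
have [[[l1 l2] l3] l4] := (l0 L1, l0 L2, l0 L3, l0 L4).
have [h4|h4] := ltP x (l L4); first by exists L4 => /=; apply/andP; split; lra.
have [h2|h2] := ltP x (l L4 + l L2); first by exists L2 => /=; apply/andP; split; lra.
have [h1|h1] := ltP x (l L4 + l L2 + l L1); first by exists L1 => /=; apply/andP; split; lra.
by exists L3 => /=; apply/andP; split; lra.
Qed.

Let E_uniq i j x : E i x -> E j x -> i = j.
Proof.
have [[[l1 l2] l3] l4] := (l0 L1, l0 L2, l0 L3, l0 L4).
rewrite /E /in_piece /= => /andP[h1 h2] /andP[h3 h4].
by case: i j h1 h2 h3 h4 => -[] //= h1 h2 h3 h4; exfalso; lra.
Qed.

Let E_D0 i : E i `<=` D0.
Proof.
have [[[l1 l2] l3] l4] := (l0 L1, l0 L2, l0 L3, l0 L4).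
rewrite /E /D0 /in_piece /in_dom /total => x /= /andP[h1 h2].
by case: i h1 h2 => /= h1 h2; apply/andP; split; lra.
Qed.

(** Stated for any partition [G] of the domain into four sets, as it serves both for the pieces [D]
    and for their images [E]. *)
Let split4 (X : set (measurableTypeR R)) (G : letter -> set (measurableTypeR R)) :
  measurable X -> (forall i, measurable (G i)) ->
  (forall i, G i `<=` D0) -> (forall x, D0 x -> exists i, G i x) ->
  (forall i j x, G i x -> G j x -> i = j) ->
  mu X = (mu (X `\` D0) + (mu (X `&` G L1) + mu (X `&` G L2) + mu (X `&` G L3)
    + mu (X `&` G L4)))%E.
Proof.
move=> mX mG GD cov uniq.
have dis i j : i <> j -> X `&` G i `&` (X `&` G j) = set0.
  by move=> ij; rewrite -subset0 => x [[_ h1] [_ h2]]; apply: ij; exact: uniq h1 h2.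
rewrite (measureDI _ mX mD0); congr (_ + _)%E.
have -> : X `&` D0 = X `&` G L1 `|` X `&` G L2 `|` X `&` G L3 `|` X `&` G L4.
  apply/seteqP; split => x.
    by move=> [Xx /cov[i Gx]]; case: i Gx => Gx; [do 3 left|do 2 left; right|left; right|right].
  by move=> [[[]|]|] [Xx /GD].
rewrite !measureU//; try (repeat apply: measurableU; exact: measurableI).
- by apply: dis.
- by rewrite setIUl !dis // setU0.
- by rewrite !setIUl !dis // !setU0.
Qed.

Lemma measurable_iet_map : measurable_fun [set: measurableTypeR R]
  (T : measurableTypeR R -> measurableTypeR R).
Proof.
move=> _ A mA; rewrite setTI.
have ms i : measurable ((fun x : measurableTypeR R => x + shift_by l i) @^-1` A).
  rewrite -[X in measurable X]setTI.
  exact: measurable_funD.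
have -> : T @^-1` A = (A `\` D0) `|` (D L1 `&` ((fun x => x + shift_by l L1) @^-1` A)) `|`
   (D L2 `&` ((fun x => x + shift_by l L2) @^-1` A)) `|`
   (D L3 `&` ((fun x => x + shift_by l L3) @^-1` A)) `|`
   (D L4 `&` ((fun x => x + shift_by l L4) @^-1` A)).
  apply/seteqP; split => x /=.
    move=> TA; have [hx|hx] := pselect (D0 x).
      have [i hi] := D0_cover hx; move: TA; rewrite (T_in hi).
      by case: i hi => hi TA; [do 3 left; right|do 2 left; right|left; right|right].
    by do 4 left; split => //; move: TA; rewrite /T; case: ifP.
  move=> [[[[[Ax hx]|[hi Ai]]|[hi Ai]]|[hi Ai]]|[hi Ai]]; rewrite ?(T_in hi) //.
  by rewrite /T; case: ifP.
by do 4 (apply: measurableU; last exact: measurableI); exact: measurableD.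
Qed.

Lemma iet_map_preserves A : measurable A -> mu (T @^-1` A) = mu A.
Proof.
move=> mA.
have mTA : measurable (T @^-1` A).
  by rewrite -[X in measurable X]setTI; exact: measurable_iet_map.
rewrite (split4 mTA mD D_D0 D0_cover D_uniq) (split4 mA mE E_D0 E_cover E_uniq).
have H i : mu (T @^-1` A `&` D i) = mu (A `&` E i).
  rewrite -[RHS](@lebesgue_shift R (shift_by l i)); last exact: measurableI.
  congr (mu _); apply/seteqP; split => x /=.
    by move=> [TA hi]; rewrite -(T_in hi); split => //; rewrite /E /= (T_in hi) addrK.
  by rewrite /E /= addrK => -[Ax hi]; split=> //; rewrite (T_in hi).
rewrite !H; congr (_ + _)%E; congr (mu _); apply/seteqP; split => x /= [Ax hx].
  by split => //; move: Ax; rewrite /T; case: ifP.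
by split => //; rewrite /T; case: ifP.
Qed.

Lemma iet_map_inj x y : T x = T y -> x = y.
Proof.
rewrite /T; case: ifPn => hx; case: ifPn => hy //.
- exact: exchange_inj.
- by move=> e; move: hy; rewrite -e exchange_dom.
- by move=> e; move: hx; rewrite e exchange_dom.
Qed.

End Preserve.

(** * Identification with a 4-interval exchange given by a permutation *)

Section Iet.
Variable R : realType.

Definition letter_of (j : nat) : letter :=
  match j with 0 => L1 | 1 => L2 | 2 => L3 | _ => L4 end.

(** The ranks, counted from 0, of the images of the four intervals, which are ordered as 4, 2, 1,
    3. *)
Definition keane_fun (j : 'I_4) : 'I_4 :=
  match val j with
  | 0 => inord 2 | 1 => inord 1 | 2 => inord 3 | _ => inord 0
  end.

Lemma keane_fun_inj : injective keane_fun.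
Proof.
move=> [[|[|[|[|//]]]] hi] [[|[|[|[|//]]]] hj]; rewrite /keane_fun /= => e;
  apply/val_inj => //=; move/(congr1 (@nat_of_ord 4)): e; by rewrite !inordK.
Qed.

Definition keane_perm : 'S_4 := perm keane_fun_inj.

Lemma iet_lengths_letter (l : letter -> R) : (forall i, 0 < l i) -> total l = 1 ->
  iet_lengths (fun j : 'I_4 => l (letter_of j)).
Proof.
move=> l0 l1; split => // ; rewrite !big_ord_recl big_ord0 /=.
by rewrite -l1 /total addr0 !addrA.
Qed.

Lemma sum_ord4 (P : pred nat) (F : nat -> R) : \sum_(k < 4 | P k) F k =
  (if P 0 then F 0 else 0) + (if P 1 then F 1 else 0) + (if P 2 then F 2 else 0)
   + (if P 3 then F 3 else 0).
Proof.
by rewrite big_mkcond !big_ord_recl big_ord0 /= addr0 !addrA.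
Qed.

Lemma iet_letter (l : letter -> R) x : (forall i, 0 < l i) ->
  iet (fun j : 'I_4 => l (letter_of j)) keane_perm x = iet_map l x.
Proof.
move=> l0.
have itvE (j : 'I_4) :
    (x \in iet_itv (fun j : 'I_4 => l (letter_of j)) j) = in_piece true l (letter_of j) x.
  rewrite /iet_itv /in_piece in_itv /=.
  rewrite (sum_ord4 (fun k => k < j)%N (l \o letter_of)).
  rewrite (sum_ord4 (fun k => k <= j)%N (l \o letter_of)).
  by case: j => -[|[|[|[|//]]]] /= _; rewrite ?addr0 ?add0r ?addrA.
rewrite /iet; case: (@pickP _ (fun j => x \in iet_itv _ j)) => [j|no].
  rewrite itvE => hj; rewrite /iet_map (in_piece_dom l0 hj) (exchange_in l0 hj) -addrA.
  congr (_ + _); rewrite (sum_ord4 (fun k => k < j)%N (l \o letter_of)).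
  rewrite big_mkcond !big_ord_recl big_ord0 /= !permE /=.
  move: hj; case: j => -[|[|[|[|//]]]] /= jlt hj; rewrite /keane_fun /= !inordK //= ?add0r ?addr0;
  ring.
rewrite /iet_map; case: ifPn => // /letter_at_in h; exfalso.
suff [j jE] : exists j : 'I_4, letter_of j = letter_at true l x.
  by have := no j; rewrite itvE jE h.
case: letter_at {h}.
- by exists (inord 0); rewrite inordK.
- by exists (inord 1); rewrite inordK.
- by exists (inord 2); rewrite inordK.
- by exists (inord 3); rewrite inordK.
Qed.

End Iet.

(** * The two ergodic measures *)

Definition is12 (a : letter) := if a is (L1 | L2) then true else false.

Record keane_seq (R : realType) := KeaneSeq {
  len :> nat -> letter -> R;
  len_gt0 : forall k i, 0 < len k i;
  len_keane : forall k i, len k i = keane (km k) (kn k) (len k.+1) i;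
  len_mass : forall k, mass12 km kn k (len k) + mass34 km kn k (len k) = 1;
  len_mass12 : forall k, mass12 km kn k (len k) <= 5 / 8;
  len_mass34 : forall k, mass34 km kn k (len k) <= 5 / 8
}.

Section Towers.
Variables (R : realType) (v : keane_seq R).
Let v0 := len_gt0 v.
Let vE := len_keane v.
Let v1 := len_mass v.
Let vS := len_mass12 v.
Let vU := len_mass34 v.
Local Notation mu := (@lebesgue_measure R).
Local Notation T := (iet_map (v 0%N)).
Local Notation h := (height km kn).
Local Notation tower := (tower km kn v T).
Local Notation base := (base v).
Local Notation level_end := (level_end v T).

Lemma iet_map_exchange x : in_dom true (v 0%N) x -> T x = exchange true (v 0%N) x.
Proof. by rewrite /iet_map => ->. Qed.

Lemma hv_ge0 k i : 0 <= (h k i)%:R * v k i.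
Proof. by rewrite mulr_ge0 // ltW. Qed.

Lemma total_le k : total (v k) <= (k.+1%:R)^-1.
Proof.
rewrite -[leRHS]mul1r ler_pdivlMr ?ltr0n // -[leRHS](v1 k) mulrC /mass12 /mass34 /total.
rewrite !mulrDr !addrA.
have H i : k.+1%:R * v k i <= (h k i)%:R * v k i.
  by rewrite ler_wpM2r ?ler_nat ?ltW //; exact: height_gt.
by do 3 (apply: lerD => //).
Qed.

Lemma v_le_total k i : v k i <= total (v k).
Proof.
have := (v0 k L1, v0 k L2, v0 k L3, v0 k L4) => -[[[? ?] ?] ?].
rewrite /total; case: i; lra.
Qed.

Lemma total0 : total (v 0) = 1.
Proof. by have := v1 0%N; rewrite /mass12 /mass34 /total /= !mul1r !addrA. Qed.

Lemma base0E x : base 0 x = (0 <= x < 1).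
Proof. by rewrite /base /in_dom /= total0. Qed.

(** By [kn_ge], every height of stage [k.+1] is at least [h k L2 * Q k ^ 5], while the lengths
    weighted by these heights add up to 1. *)
Lemma height_total_le k : (h k L2)%:R * total (v k.+1) <= ((Q k)%:R ^+ 5)^-1.
Proof.
have Q0 : 0 < (Q k)%:R ^+ 5 :> R by rewrite exprn_gt0 // ltr0n gap_gt0.
rewrite -[leRHS]mul1r ler_pdivlMr // -[leRHS](v1 k.+1) /mass12 /mass34 /total.
have H i : (h k L2)%:R * v k.+1 i * (Q k)%:R ^+ 5 <= (h k.+1 i)%:R * v k.+1 i.
  rewrite mulrAC ler_wpM2r ?(ltW (v0 _ _)) // -natrX -natrM ler_nat.
  exact: leq_trans (kn_ge k) (kn_le_height k i).
by rewrite !mulrDr !mulrDl !addrA; do 3 (apply: lerD => //).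
Qed.

Definition level k i j : set (measurableTypeR R) :=
  `[level_end k i j, level_end k i j + v k i[%classic.

Lemma levelE k i j x : level k i j x <->
  level_end k i j <= x < level_end k i j + v k i.
Proof. by rewrite /level /= in_itv. Qed.

Lemma measurable_level k i j : measurable (level k i j).
Proof. exact: measurable_itv. Qed.

Lemma mu_level k i j : mu (level k i j) = (v k i)%:E.
Proof. by rewrite lebesgue_co // ltW. Qed.

Lemma mu_level_le k i j : (mu (level k i j) <= (v k i)%:E)%E.
Proof. by rewrite mu_level. Qed.

Definition tset k i : set (measurableTypeR R) := [set x | tower k i x].

Lemma tsetP k i x : tset k i x <-> exists2 j, (j < h k i)%N & level k i j x.
Proof.
rewrite /tset /=; have := @towerP R km kn v T v0 vE iet_map_exchange k i x => e.
by rewrite e; split=> -[j jh]; rewrite ?levelE => ?; exists j => //; rewrite ?levelE.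
Qed.

Lemma tsetE k i : tset k i = \big[setU/set0]_(j < h k i) level k i j.
Proof.
rewrite -bigcup_mkord; apply/seteqP; split => x.
  by move=> /tsetP[j jh hx]; exists j.
by move=> [j jh hx]; apply/tsetP; exists j.
Qed.

Lemma measurable_tset k i : measurable (tset k i).
Proof. by rewrite tsetE; apply: bigsetU_measurable => j _; exact: measurable_level. Qed.

Lemma mu_tset_le k i : (mu (tset k i) <= ((h k i)%:R * v k i)%:E)%E.
Proof.
have -> : (h k i)%:R = (count xpredT (iota 0 (h k i)))%:R :> R by rewrite count_predT size_iota.
apply: (@measure_union_le R _ _ mu _ xpredT (level k i)).
- exact: ltW.
- exact: measurable_tset.
- by move=> j; exact: measurable_level.
- by move=> j; exact: mu_level_le.
- by move=> x /tsetP[j jh hx]; exists j.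
Qed.

Definition cset k (P : pred letter) : set (measurableTypeR R) :=
  [set x | exists2 a, P a & tset k a x].

Lemma measurable_cset k P : measurable (cset k P).
Proof.
have -> : cset k P = (if P L1 then tset k L1 else set0) `|` (if P L2 then tset k L2 else set0)
   `|` (if P L3 then tset k L3 else set0) `|` (if P L4 then tset k L4 else set0).
  apply/seteqP; split => x.
    move=> [a Pa ha]; case: a Pa ha => -> ?; [do 3 left|do 2 left; right|left; right|right]=> //.
  have K a : (if P a then tset k a else set0) x -> cset k P x.
    by case: ifPn => // Pa hx; exists a.
  by move=> [[[|]|]|] /K.
have m_if (c : bool) i : measurable (if c then tset k i else set0).
  by case: c; [exact: measurable_tset|exact: measurable0].
by do 3 (apply: measurableU; last exact: m_if); exact: m_if.
Qed.

Lemma mu_meet k i P : (mu (tset k.+1 i `&` cset k P) <=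
  ((sumn [seq h k a | a <- word (km k) (kn k) i & P a])%:R * v k.+1 i)%:E)%E.
Proof.
rewrite -count_expand; set s := expand _ _ _ _.
have -> : count P s = count (fun j => P (nth L1 s j)) (iota 0 (h k.+1 i)).
  by rewrite heightS -size_expand -/s -{1}(mkseq_nth L1 s) count_map.
apply: (@measure_union_le R _ _ mu _ _ (level k.+1 i)).
- exact: ltW.
- by apply: measurableI; [exact: measurable_tset|exact: measurable_cset].
- by move=> j; exact: measurable_level.
- by move=> j; exact: mu_level_le.
- move=> x [h1 [a Pa h2]].
  have [j jh [ja jx]] := @tower_meet R km kn v T v0 vE iet_map_exchange k i a x h1 h2.
  by exists j => //; split; [rewrite /s ja|apply/levelE].
Qed.

Definition towers12 k := cset k is12.
Definition towers34 k := cset k (predC is12).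
Local Notation S := towers12.
Local Notation U := towers34.

Lemma towers_cover k x : 0 <= x < 1 -> S k x \/ U k x.
Proof.
rewrite -base0E => hx.
have [i hi] := @tower_cover R km kn v T v0 vE iet_map_exchange k x hx.
by case E : (is12 i); [left|right]; exists i => //=; rewrite E.
Qed.

Lemma tset_uniq k i j x : tset k i x -> tset k j x -> i = j.
Proof. exact: (@tower_uniq R km kn v T v0 vE iet_map_exchange). Qed.

Lemma towers_disj k x : S k x -> ~ U k x.
Proof. by move=> [i hi ti] [j hj tj]; move: hj; rewrite /= -(tset_uniq ti tj) hi. Qed.

Lemma tset_01 k i x : tset k i x -> 0 <= x < 1.
Proof. by rewrite -base0E; exact: (@tower_base0 R km kn v T v0 vE iet_map_exchange). Qed.

Lemma cset_01 k P x : cset k P x -> 0 <= x < 1.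
Proof. by move=> [i _ /tset_01]. Qed.

Lemma mu_towers12_le k : (mu (S k) <= (5 / 8)%:E)%E.
Proof.
apply: le_trans (_ : _ <= (mass12 km kn k (v k))%:E)%E _; last by rewrite lee_fin.
apply: (@measure_sub_le R _ _ mu _ _ (tset k L1 `|` tset k L2)).
- exact: measurable_cset.
- by apply: measurableU; exact: measurable_tset.
- by move=> x [[] //= _ ?]; [left|right].
- by apply: measureU_le; try exact: measurable_tset; exact: mu_tset_le.
Qed.

Lemma mu_towers34_le k : (mu (U k) <= (5 / 8)%:E)%E.
Proof.
apply: le_trans (_ : _ <= (mass34 km kn k (v k))%:E)%E _; last by rewrite lee_fin.
apply: (@measure_sub_le R _ _ mu _ _ (tset k L3 `|` tset k L4)).
- exact: measurable_cset.
- by apply: measurableU; exact: measurable_tset.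
- by move=> x [[] //= _ ?]; [left|right].
- by apply: measureU_le; try exact: measurable_tset; exact: mu_tset_le.
Qed.

(* This bound is far smaller than that of [mu_towers34_12]: the asymmetry
   between the two ergodic measures comes from here. *)
Lemma mu_towers12_34 k : (mu (S k `&` U k.+1) <= (((Q k)%:R ^+ 5)^-1)%:E)%E.
Proof.
apply: (@le_trans _ _ ((h k L1)%:R * v k.+1 L3 + (h k L1)%:R * v k.+1 L4)%:E).
  apply: (@measure_sub_le R _ _ mu _ _ ((tset k.+1 L3 `&` S k) `|` (tset k.+1 L4 `&` S k))).
  - by apply: measurableI; exact: measurable_cset.
  - by apply: measurableU; apply: measurableI; try exact: measurable_tset; exact: measurable_cset.
  - by move=> x [hS [[] //= _ ?]]; [left|right].
  - have F N : [seq a <- nseq N L3 | is12 a] = [::] by elim: N.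
    apply: measureU_le; try (by apply: measurableI; try exact: measurable_tset; exact: measurable_cset).
      by apply: le_trans (mu_meet k L3 is12) _; rewrite lee_fin /= F /= addn0.
    by apply: le_trans (mu_meet k L4 is12) _; rewrite lee_fin /= F /= addn0.
rewrite lee_fin; apply: le_trans (height_total_le k); rewrite -mulrDr.
have := (v0 k.+1 L1, v0 k.+1 L2) => -[? ?].
apply: ler_pM => //; first by rewrite addr_ge0 // ltW.
  by rewrite ler_nat height_le_L2.
by rewrite /total; lra.
Qed.

Lemma mu_towers34_12 k : (mu (U k `&` S k.+1) <= ((2 ^+ (k + 4))^-1)%:E)%E.
Proof.
pose c := (h k L4 + (kn k).+1 * h k L3)%N.
apply: (@le_trans _ _ (c%:R * v k.+1 L1 + c%:R * v k.+1 L2)%:E).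
  apply: (@measure_sub_le R _ _ mu _ _ ((tset k.+1 L1 `&` U k) `|` (tset k.+1 L2 `&` U k))).
  - by apply: measurableI; exact: measurable_cset.
  - by apply: measurableU; apply: measurableI; try exact: measurable_tset; exact: measurable_cset.
  - by move=> x [hS [[] //= _ ?]]; [left|right].
  - have F N : [seq a <- nseq N L2 | predC is12 a] = [::] by elim: N.
    have G N : sumn [seq h k a | a <- [seq a <- nseq N L3 | predC is12 a]] = (N * h k L3)%N.
      by rewrite (_ : [seq a <- _ | _] = nseq N L3) ?map_nseq ?sumn_nseq 1?mulnC //; elim: N => //= N ->.
    apply: measureU_le; try (by apply: measurableI; try exact: measurable_tset; exact: measurable_cset).
      apply: le_trans (mu_meet k L1 (predC is12)) _.
      by rewrite /word [X in map _ X]/= filter_cat F cat0s map_cons [sumn _]/= G.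
    apply: le_trans (mu_meet k L2 (predC is12)) _.
    by rewrite /word [X in map _ X]/= filter_cat F cat0s map_cons [sumn _]/= G.
rewrite lee_fin -[leRHS]mul1r ler_pdivlMr ?exprn_gt0 //.
rewrite -[leRHS](v1 k.+1) -[leLHS]addr0; apply: lerD; last first.
  by rewrite /mass34 addr_ge0 // hv_ge0.
rewrite mulrDl /mass12.
have H i : i = L1 \/ i = L2 -> c%:R * v k.+1 i * 2 ^+ (k + 4) <= (h k.+1 i)%:R * v k.+1 i.
  move=> iE; rewrite mulrAC ler_wpM2r ?(ltW (v0 _ _)) // -natrX -natrM ler_nat mulnC.
  exact: height_U.
by apply: lerD; apply: H; [left|right].
Qed.

(** Both [v k L1] and [v k L4] are at most [total (v k.+1)], so towers 1 and 4 are negligible: up to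
    summable errors only towers 2 and 3 remain. *)
Lemma mu_tset_L1 k : (mu (tset k L1) <= (((Q k)%:R ^+ 5)^-1)%:E)%E.
Proof.
apply: le_trans (mu_tset_le k L1) _; rewrite lee_fin; apply: le_trans (height_total_le k).
apply: ler_pM => //; [exact: ltW|by rewrite ler_nat height_le_L2|].
rewrite vE /= /total; have := (v0 k.+1 L1, v0 k.+1 L2) => -[? ?]; lra.
Qed.

Lemma mu_tset_L4 k : (mu (tset k L4) <= (((Q k)%:R ^+ 5)^-1)%:E)%E.
Proof.
apply: le_trans (mu_tset_le k L4) _; rewrite lee_fin; apply: le_trans (height_total_le k).
by apply: ler_pM => //; [exact: ltW|rewrite ler_nat height_le_L2|rewrite vE].
Qed.

(** The words of [L3] and [L4] contain no [L2]. This gains one stage: the second measure of tower 2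
    of stage [k] is controlled by [Q k.+1] instead of [Q k]. *)
Lemma tset_L2_towers34 k x : tset k L2 x -> ~ U k.+1 x.
Proof.
move=> h2 [i iU hi].
have [j jh [ja jx]] := @tower_meet R km kn v T v0 vE iet_map_exchange k i L2 x hi h2.
have : has (fun a => if a is L2 then true else false)
    (expand km kn k (word (km k) (kn k) i)).
  apply/(has_nthP L1); exists j; last by rewrite ja.
  by rewrite size_expand -heightS.
have F N M : has (fun a => if a is L2 then true else false)
    (flatten [seq nseq (h k a) a | a <- nseq N L3] ++ nseq M L1) = false.
  by rewrite has_cat has_nseq /= andbF orbF; elim: N => //= N IH; rewrite has_cat IH has_nseq andbF.
rewrite /expand /word; case: i iU {hi ja jx jh} => //= _;
  rewrite !has_cat !has_nseq /= !andbF /= -[flatten _]cats0 (F _ 0%N) //.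
Qed.

Lemma top_base k i x : base 0 x -> ~ base k (T x) -> (tset k i x <-> tset k i (T x)).
Proof.
move=> hx nb; have dir a : tset k a x -> tset k a (T x).
  move=> [z [j [hz jh xE]]]; exists z, j.+1; split => //; last by rewrite xE.
  rewrite ltn_neqAle jh andbT; apply/eqP => jE; apply: nb.
  by rewrite xE -iterS jE; apply: (@base_return R km kn v T v0 vE iet_map_exchange).
split=> [|hT]; first exact: dir.
have [a ha] := @tower_cover R km kn v T v0 vE iet_map_exchange k x hx.
by rewrite (tset_uniq hT (dir a ha)).
Qed.

End Towers.

Lemma mnormalizeE d (S : measurableType d) (R : realType)
    (nu : {measure set S -> \bar R}) (P : probability S R) (c : R) (B : set S) :
  0 < c -> nu setT = c%:E -> mnormalize nu P B = (nu B * (c^-1)%:E)%E.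
Proof. by move=> c0 nuT; rewrite /mnormalize nuT eqe gt_eqF. Qed.

(** * Normalised restrictions of Lebesgue measure *)

Section RestrictedLebesgue.
Variable R : realType.
Local Notation mu := (@lebesgue_measure R).
Implicit Types (A B : set (measurableTypeR R)).

Lemma lebesgueDI A B : measurable A -> measurable B ->
  mu A = (mu (A `\` B) + mu (A `&` B))%E.
Proof. exact: measureDI. Qed.

Lemma lebesgue01 : mu `[0, 1[%classic = 1%:E.
Proof. by have := @lebesgue_co R 0 1 ler01; rewrite add0r. Qed.

Lemma lebesgue01_le : (mu `[0%R, 1%R[%classic <= 1%:E)%E.
Proof. by rewrite lebesgue01. Qed.

Lemma ereal_le_inv (x : \bar R) (c : R) : (0 <= x)%E ->
  (forall k : nat, (x <= (c * (k.+1%:R)^-1)%:E)%E) -> x = 0%E.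
Proof.
move=> x0 H; have xfin : x \is a fin_num.
  by rewrite ge0_fin_numE//; apply: le_lt_trans (H 0%N) _; rewrite ltry.
apply/eqP; rewrite eq_le x0 andbT leNgt; apply/negP => xpos.
have rpos : 0 < fine x by rewrite fine_gt0 // xpos -ge0_fin_numE.
pose N := Num.bound `|c / fine x|.
have : c / fine x < N.+1%:R.
  apply: le_lt_trans (ler_norm _) _; apply: lt_trans (archi_boundP _) _ => //.
  by rewrite ltr_nat.
rewrite ltr_pdivrMr // => cN.
have := H N; rewrite -(fineK xfin) lee_fin ler_pdivlMr ?ltr0n // leNgt => /negP; apply.
by rewrite mulrC.
Qed.

Variables (A : set (measurableTypeR R)) (mA : measurable A).

Definition restr_prob : probability (measurableTypeR R) R :=
  mnormalize (mrestr mu mA) (dirac (0 : measurableTypeR R)).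

Hypothesis A01 : A `<=` `[0, 1[%classic.
Hypothesis A4 : ((4^-1)%:E <= mu A)%E.

Let mA1 : (mu A <= 1%:E)%E.
Proof.
apply: (@measure_sub_le R _ _ mu _ _ `[0, 1[%classic mA _ A01); first exact: measurable_itv.
exact: lebesgue01_le.
Qed.

Let a := fine (mu A).
Let aE : mu A = a%:E.
Proof. by rewrite fineK // ge0_fin_numE // (le_lt_trans mA1) // ltry. Qed.
Let a4 : 4^-1 <= a. Proof. by rewrite -lee_fin -aE. Qed.
Let a1 : a <= 1. Proof. by rewrite -lee_fin -aE. Qed.

Lemma restr_probE B : restr_prob B = (mu (B `&` A) * (a^-1)%:E)%E.
Proof.
rewrite -[RHS]/(mrestr mu mA B * _)%E; apply: mnormalizeE.
  exact: lt_le_trans a4.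
by rewrite /= /mrestr setTI; exact: aE.
Qed.

Lemma restr_prob_le B : measurable B -> (restr_prob B <= 4%:E * mu B)%E.
Proof.
move=> mB; rewrite restr_probE muleC; apply: lee_pmul => //.
- by rewrite lee_fin invr_ge0; apply: le_trans a4.
- by rewrite lee_fin -[leRHS]invrK lef_pV2 ?posrE // (lt_le_trans _ a4).
- by apply: le_measure; rewrite ?inE //; exact: measurableI.
Qed.

Lemma restr_prob_le_diff B (c : R) : measurable B -> (mu (B `&` A) <= c%:E)%E ->
  (restr_prob B <= (4 * c)%:E)%E.
Proof.
move=> mB h; rewrite restr_probE muleC EFinM; apply: lee_pmul => //.
- by rewrite lee_fin invr_ge0; apply: le_trans a4.
- by rewrite lee_fin -[leRHS]invrK lef_pV2 ?posrE // (lt_le_trans _ a4).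
Qed.

Lemma restr_prob_ge B : (mu (B `&` A) <= restr_prob B)%E.
Proof.
rewrite restr_probE -{1}[mu (B `&` A)]mule1; apply: lee_wpmul2l => //.
by rewrite lee_fin invf_ge1 // (lt_le_trans _ a4).
Qed.

Lemma restr_prob_full : restr_prob `[0, 1[%classic = 1%E.
Proof.
rewrite restr_probE (_ : _ `&` A = A) ?setIidr //.
by rewrite aE -EFinM divff // gt_eqF // (lt_le_trans _ a4).
Qed.

(** Invariance of [A] is assumed modulo null sets only, which is what [basin_invariant] provides. *)
Lemma restr_invariant (T : R -> R) :
  (forall B, measurable B -> measurable (T @^-1` B)) ->
  (forall B, measurable B -> mu (T @^-1` B) = mu B) ->
  mu (A `\` T @^-1` A) = 0%E -> mu (T @^-1` A `\` A) = 0%E ->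
  invariant_on01 T restr_prob.
Proof.
move=> mT pT h1 h2; split; first exact: restr_prob_full.
move=> B mB; rewrite !restr_probE; congr (_ * _)%E.
have mTB := mT _ mB; have mTA := mT _ mA.
rewrite -[RHS]pT; last exact: measurableI.
rewrite (lebesgueDI (A := T @^-1` B `&` A) (B := T @^-1` A)) //; last exact: measurableI.
rewrite (lebesgueDI (A := T @^-1` (B `&` A)) (B := A)) //; last first.
  by apply: mT; exact: measurableI.
have Z (X Y : set (measurableTypeR R)) : measurable X -> measurable Y -> X `<=` Y ->
    mu Y = 0%E -> mu X = 0%E.
  by move=> mX mY XY Y0; exact: (subset_measure0 mX mY XY Y0).
rewrite (Z ((T @^-1` B `&` A) `\` T @^-1` A) (A `\` T @^-1` A)) //; first last.
- by move=> x [[]].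
- exact: measurableD.
- by apply: measurableD => //; exact: measurableI.
rewrite (Z ((T @^-1` (B `&` A)) `\` A) (T @^-1` A `\` A)) //; first last.
- by move=> x [[_ ?] ?].
- exact: measurableD.
- by apply: measurableD => //; apply: mT; exact: measurableI.
congr (_ + mu _)%E; apply/seteqP; split => x /=; first by move=> [[? ?] ?].
by move=> [[? ?] ?].
Qed.

End RestrictedLebesgue.

(** * The two invariant sets and their measures *)

Section Basin.
Variables (R : realType) (v : keane_seq R).
Local Notation mu := (@lebesgue_measure R).
Local Notation T := (iet_map (v 0%N)).
Local Notation S := (towers12 v).
Local Notation U := (towers34 v).
Local Notation tset := (tset v).

Definition basin : set (measurableTypeR R) := \bigcup_K \bigcap_(k >= K) S k.
(** A complement rather than the lower limit of the sets [U k], so that the two sets partition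
    $[0,1)$ exactly. *)
Definition cobasin : set (measurableTypeR R) := `[0, 1[%classic `\` basin.

Lemma measurable_towers12 k : measurable (S k). Proof. exact: measurable_cset. Qed.
Lemma measurable_towers34 k : measurable (U k). Proof. exact: measurable_cset. Qed.

Lemma measurable_basin : measurable basin.
Proof.
apply: bigcup_measurable => K _; apply: bigcap_measurable; first by exists K => /=.
by move=> k _; exact: measurable_towers12.
Qed.

Lemma measurable_cobasin : measurable cobasin.
Proof. by apply: measurableD; [exact: measurable_itv|exact: measurable_basin]. Qed.

Lemma towers12_01 k x : S k x -> 0 <= x < 1. Proof. exact: cset_01. Qed.

Lemma basin_01 : basin `<=` `[0, 1[%classic.
Proof. by move=> x [K _ /(_ K (leqnn K)) /towers12_01] /=; rewrite in_itv. Qed.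

Lemma cobasin_01 : cobasin `<=` `[0, 1[%classic.
Proof. by move=> x []. Qed.

Let Q0 k : 0 < (Q k)%:R :> R. Proof. by rewrite ltr0n gap_gt0. Qed.

(** A point of [S k] outside the basin passes from [S] to [U] at some stage [k + i], at a cost of
    the inverse fifth power of [Q (k + i)]. Four of the factors are kept as a power of [Q k], the
    fifth dominates [2 ^ k * 2 ^ i.+1]. *)
Lemma mu_towers12_basin k :
  (mu (S k `\` basin) <= (((Q k)%:R ^+ 4 * 2 ^+ k)^-1)%:E)%E.
Proof.
apply: (@measure_tail_le R _ _ mu _ (fun i => S (k + i) `&` U (k + i).+1)).
- by rewrite invr_ge0 mulr_ge0 // exprn_ge0.
- by apply: measurableD; [exact: measurable_towers12|exact: measurable_basin].
- by move=> i; apply: measurableI; [exact: measurable_towers12|exact: measurable_towers34].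
- move=> i; apply: le_trans (mu_towers12_34 v (k + i)) _; rewrite lee_fin.
  rewrite -invfM lef_pV2 ?posrE ?mulr_gt0 ?exprn_gt0 ?ltr0n ?expn_gt0 ?gap_gt0 //.
  rewrite [leRHS]exprSr -mulrA; apply: ler_pM.
  + by rewrite exprn_ge0.
  + by rewrite mulr_ge0 ?exprn_ge0.
  + by rewrite lerXn2r ?nnegrE // ler_nat gap_le // leq_addr.
  + rewrite -natrX -natrM ler_nat -expnD.
    apply: leq_trans (gap_ge _); rewrite leq_pexp2l //; lia.
- move=> x [Sx Ax]; apply: contrapT => N; apply: Ax.
  have SS i : S (k + i) x.
    elim: i => [|i IH]; first by rewrite addn0.
    rewrite addnS; have [//|Ux] := towers_cover v (k + i).+1 (towers12_01 Sx).
    by exfalso; apply: N; exists i.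
  exists k => // j kj; have -> : j = (k + (j - k))%N by rewrite subnKC.
  exact: SS.
Qed.

(** Conversely a point of the basin outside [S k] has to pass from [U] to [S] later on. *)
Lemma mu_basin_towers12 k : (mu (basin `\` S k) <= ((2 ^+ (k + 3))^-1)%:E)%E.
Proof.
apply: (@measure_tail_le R _ _ mu _ (fun i => U (k + i) `&` S (k + i).+1)).
- by rewrite invr_ge0 exprn_ge0.
- by apply: measurableD; [exact: measurable_basin|exact: measurable_towers12].
- by move=> i; apply: measurableI; [exact: measurable_towers34|exact: measurable_towers12].
- move=> i; apply: le_trans (mu_towers34_12 v (k + i)) _; rewrite lee_fin.
  rewrite -invfM lef_pV2 ?posrE ?mulr_gt0 ?exprn_gt0 ?ltr0n ?expn_gt0 //.
  by rewrite natrX -exprD (_ : k + 3 + i.+1 = k + i + 4)%N //; lia.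
- move=> x [Ax Sx]; apply: contrapT => N.
  have x01 : 0 <= x < 1 by have := basin_01 Ax; rewrite /= in_itv.
  have UU i : U (k + i) x.
    elim: i => [|i IH]; first by rewrite addn0; have [/Sx|] := towers_cover v k x01.
    rewrite addnS; have [Sx'|//] := towers_cover v (k + i).+1 x01.
    by exfalso; apply: N; exists i.
  have [K _ hK] := Ax; have := hK (k + K)%N (leq_addl _ _).
  by move=> /towers_disj; apply; exact: UU.
Qed.

Lemma gap_ge64 k : 64 <= (Q k)%:R :> R.
Proof.
rewrite ler_nat; apply: leq_trans (gap_ge k); rewrite (_ : 64 = 2 ^ 6)%N //.
by rewrite leq_pexp2l // leq_addl.
Qed.

Let mu01 := @lebesgue01 R.

Lemma fin_sub01 (A : set (measurableTypeR R)) : measurable A -> A `<=` `[0, 1[%classic ->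
  mu A = (fine (mu A))%:E.
Proof.
move=> mA A01; rewrite fineK // ge0_fin_numE //.
apply: (@le_lt_trans _ _ 1%:E); last exact: ltry.
by rewrite -mu01; apply: le_measure; rewrite ?inE //; exact: measurable_itv.
Qed.

(** The rest of $[0,1)$ lies in [S 0] minus the basin, of measure at most 1/8, or in [U 0], of
    measure at most 5/8; this leaves 1/4. *)
Lemma mu_basin_ge : ((4^-1)%:E <= mu basin)%E.
Proof.
rewrite (fin_sub01 measurable_basin basin_01) lee_fin.
have H : (mu `[0%R, 1%R[%classic <= (fine (mu basin) + 8^-1 + 5 / 8)%:E)%E.
  apply: (@measure_sub_le R _ _ mu _ _ (basin `|` (S 0%N `\` basin) `|` U 0%N)).
  - exact: measurable_itv.
  - apply: measurableU; last exact: measurable_towers34.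
    by apply: measurableU; [|apply: measurableD]; (exact: measurable_basin || exact: measurable_towers12).
  - move=> x /=; rewrite in_itv /= => /(towers_cover v 0%N)[Sx|]; last by right.
    by left; have [Ax|Ax] := pselect (basin x); [left|right].
  - apply: measureU_le; last exact: mu_towers34_le; try exact: measurable_towers34.
      by apply: measurableU; [|apply: measurableD]; (exact: measurable_basin || exact: measurable_towers12).
    apply: measureU_le; [exact: measurable_basin| | |].
    + by apply: measurableD; (exact: measurable_basin || exact: measurable_towers12).
    + by rewrite -(fin_sub01 measurable_basin basin_01).
    + apply: le_trans (mu_towers12_basin 0) _; rewrite lee_fin mulr1 lef_pV2 ?posrE ?exprn_gt0 //.
      apply: (@le_trans _ _ ((Q 0)%:R ^+ 1)); first by rewrite expr1; have := gap_ge64 0; lra.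
      by rewrite ler_weXn2l //; have := gap_ge64 0; lra.
by move: H; rewrite mu01 lee_fin; lra.
Qed.

Lemma mu_cobasin_ge : ((4^-1)%:E <= mu cobasin)%E.
Proof.
rewrite (fin_sub01 measurable_cobasin cobasin_01) lee_fin.
have H : (mu `[0%R, 1%R[%classic <= (fine (mu cobasin) + 8^-1 + 5 / 8)%:E)%E.
  have mBS : measurable (basin `\` S 0%N).
    by apply: measurableD; (exact: measurable_basin || exact: measurable_towers12).
  apply: (@measure_sub_le R _ _ mu _ _ (cobasin `|` (basin `\` S 0%N) `|` S 0%N)).
  - exact: measurable_itv.
  - apply: measurableU; last exact: measurable_towers12.
    by apply: measurableU => //; exact: measurable_cobasin.
  - move=> x x01; have [Ax|Ax] := pselect (basin x); last by left; left.
    by have [Sx|Sx] := pselect (S 0%N x); [right|left; right].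
  - apply: measureU_le; last exact: mu_towers12_le; try exact: measurable_towers12.
      by apply: measurableU => //; exact: measurable_cobasin.
    apply: measureU_le => //; first exact: measurable_cobasin.
    + by rewrite -(fin_sub01 measurable_cobasin cobasin_01).
    + apply: le_trans (mu_basin_towers12 0) _; rewrite lee_fin lef_pV2 ?posrE ?exprn_gt0 //.
      by rewrite add0n; lra.
by move: H; rewrite mu01 lee_fin; lra.
Qed.

Definition lam2 := restr_prob measurable_basin.
Definition lam3 := restr_prob measurable_cobasin.

Lemma measurable_T (B : set (measurableTypeR R)) : measurable B -> measurable (T @^-1` B).
Proof.
move=> mB; rewrite -[X in measurable X]setTI.
exact: (measurable_iet_map (len_gt0 v 0%N)).
Qed.

Definition base_set k : set (measurableTypeR R) := [set x | base v k x].

Lemma base_setE k : base_set k = level v k L1 0 `|` level v k L2 0 `|` level v k L3 0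
  `|` level v k L4 0.
Proof.
have E i x : level v k i 0 x <-> inJ v k i x.
  by rewrite /level /= in_itv /= inJ_left /level_end.
apply/seteqP; split => x.
  by move=> /base_inJ[i] /E; case: i => ?; [do 3 left|do 2 left; right|left; right|right].
by move=> [[[|]|]|] /E; exact/inJ_base/len_gt0.
Qed.

Lemma measurable_base_set k : measurable (base_set k).
Proof. by rewrite base_setE; do 3 (apply: measurableU; last exact: measurable_level); exact: measurable_level. Qed.

Lemma mu_base_set k : (mu (base_set k) <= (total (v k))%:E)%E.
Proof.
rewrite base_setE /total.
have ml i j := @measurable_level R v k i j; have ll i j := @mu_level_le R v k i j.
apply: measureU_le; [by do 2 apply: measurableU => //|exact: ml| |exact: ll].
apply: measureU_le; [by apply: measurableU|exact: ml| |exact: ll].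
by apply: measureU_le; [exact: ml|exact: ml|exact: ll|exact: ll].
Qed.

Lemma T_01 x : (0 <= T x < 1) = (0 <= x < 1).
Proof.
rewrite -!(base0E v); apply/idP/idP => [|h]; last first.
  by apply: (@T_base0 R km kn v T (len_gt0 v) (len_keane v) _ x h) => y; exact: iet_map_exchange.
by have [//|hx] := boolP (base v 0 x); rewrite /iet_map ifN // (negbTE hx).
Qed.

Lemma towers12_T k x : 0 <= x < 1 -> ~ base_set k (T x) -> (S k x <-> S k (T x)).
Proof.
rewrite -(base0E v) => hx nb.
have e i : tset k i x <-> tset k i (T x) by exact: (@top_base R v k i x hx nb).
by split => -[i iS hi]; exists i => //; apply/e.
Qed.

(** At each stage [x] and [T x] lie in the same tower unless [T x] is in the base, an event of
    measure at most [k.+1%:R^-1]. Replacing the basin by [S k] at [x] and at [T x] costs two more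
    errors of this size, and [k] is arbitrary. *)
Lemma basin_invariant :
  mu (basin `\` T @^-1` basin) = 0%E /\ mu (T @^-1` basin `\` basin) = 0%E.
Proof.
have mb := measurable_basin; have mTb := measurable_T mb.
have mS := measurable_towers12; have mTS k := measurable_T (mS k).
have mTB k := measurable_T (measurable_base_set k).
have pres B : measurable B -> mu (T @^-1` B) = mu B := @iet_map_preserves R _ (len_gt0 v 0%N) B.
have k2 k : (2 ^+ k)^-1 <= k.+1%:R^-1 :> R.
  by rewrite lef_pV2 ?posrE ?exprn_gt0 ?ltr0n // -natrX ler_nat ltn_expl.
have b1 k : (mu (basin `\` S k) <= (k.+1%:R^-1)%:E)%E.
  apply: le_trans (mu_basin_towers12 k) _; rewrite lee_fin; apply: le_trans (k2 k).
  by rewrite lef_pV2 ?posrE ?exprn_gt0 // ler_weXn2l ?leq_addr // ler1n.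
have b2 k : (mu (S k `\` basin) <= (k.+1%:R^-1)%:E)%E.
  apply: le_trans (mu_towers12_basin k) _; rewrite lee_fin; apply: le_trans (k2 k).
  rewrite lef_pV2 ?posrE ?mulr_gt0 ?exprn_gt0 // ler_peMl ?exprn_ge0 //.
  by rewrite exprn_ege1 // ler1n gap_gt0.
have b3 k : (mu (T @^-1` base_set k) <= (k.+1%:R^-1)%:E)%E.
  rewrite pres; last exact: measurable_base_set.
  by apply: le_trans (mu_base_set k) _; rewrite lee_fin; exact: total_le.
have presle B c : measurable B -> (mu B <= c)%E -> (mu (T @^-1` B) <= c)%E.
  by move=> mB; rewrite pres.
have mD1 k : measurable (basin `\` S k) by exact: measurableD.
have mD2 k : measurable (S k `\` basin) by exact: measurableD.
split; apply: (@ereal_le_inv R _ 3) => // k.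
- rewrite (_ : 3 * _ = k.+1%:R^-1 + k.+1%:R^-1 + k.+1%:R^-1); last by ring.
  apply: (@measure_sub_le R _ _ mu _ _ ((basin `\` S k) `|` (T @^-1` base_set k) `|`
    T @^-1` (S k `\` basin))).
  + exact: measurableD.
  + by apply: measurableU; [apply: measurableU; [|exact: mTB]|exact: measurable_T].
  + move=> x [bx nTbx]; have [Sx|Sx] := pselect (S k x); last by left; left.
    have [Bx|Bx] := pselect (base_set k (T x)); first by left; right.
    by right; split => //; apply/(towers12_T (towers12_01 Sx) Bx).
  + apply: measureU_le.
    * by apply: measurableU; [|exact: mTB].
    * exact: measurable_T.
    * by apply: measureU_le; [exact: mD1|exact: mTB|exact: b1|exact: b3].
    * exact: presle (mD2 k) (b2 k).
- rewrite (_ : 3 * _ = k.+1%:R^-1 + k.+1%:R^-1 + k.+1%:R^-1); last by ring.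
  apply: (@measure_sub_le R _ _ mu _ _ ((S k `\` basin) `|` (T @^-1` base_set k) `|`
    T @^-1` (basin `\` S k))).
  + exact: measurableD.
  + by apply: measurableU; [apply: measurableU; [|exact: mTB]|exact: measurable_T].
  + move=> x [bx nTbx]; have [Sx|Sx] := pselect (S k (T x)); last by right.
    have [Bx|Bx] := pselect (base_set k (T x)); first by left; right.
    left; left; split => //; apply/(towers12_T _ Bx) => //.
    by rewrite -T_01; exact: towers12_01 Sx.
  + apply: measureU_le.
    * by apply: measurableU; [|exact: mTB].
    * exact: measurable_T.
    * by apply: measureU_le; [exact: mD2|exact: mTB|exact: b2|exact: b3].
    * exact: presle (mD1 k) (b1 k).
Qed.

Lemma lam2_invariant : invariant_on01 T lam2.
Proof.
have [h1 h2] := basin_invariant.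
apply: restr_invariant h1 h2; [exact: basin_01|exact: mu_basin_ge|exact: measurable_T|].
by move=> B; exact: iet_map_preserves (len_gt0 v 0%N) _.
Qed.

Lemma lam3_invariant : invariant_on01 T lam3.
Proof.
have [h1 h2] := basin_invariant.
apply: restr_invariant; [exact: cobasin_01|exact: mu_cobasin_ge|exact: measurable_T| | |].
- by move=> B; exact: iet_map_preserves (len_gt0 v 0%N) _.
- rewrite (_ : _ `\` _ = T @^-1` basin `\` basin) //; apply/seteqP; split => x.
    move=> [[x01 bx] nT]; split => //; apply: contrapT => bT; apply: nT; split => //.
    by move: x01; rewrite /= !in_itv /= T_01.
  move=> [bT bx]; split; last by move=> [].
  by split => //; have := basin_01 bT; rewrite /= !in_itv /= T_01.
- rewrite (_ : _ `\` _ = basin `\` T @^-1` basin) //; apply/seteqP; split => x.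
    move=> [[x01 bx] nT]; split => //; apply: contrapT => bT; apply: nT; split => //.
    by move: x01; rewrite /= !in_itv /= T_01.
  move=> [bT bx]; split; last by move=> [].
  by split => //; have := basin_01 bT; rewrite /= !in_itv /= T_01.
Qed.

(** A point of the basin outside tower 2 is outside [S k] or in the thin tower 1. *)
Lemma lam2_tset k : (lam2 (~` tset k L2) <= ((2 ^+ k)^-1)%:E)%E.
Proof.
rewrite (_ : (2 ^+ k)^-1 = 4 * (2 ^+ (k + 2))^-1 :> R); last first.
  by rewrite exprD invfM mulrCA (_ : 4 / 2 ^+ 2 = 1) ?mulr1 // -natrX divff.
apply: restr_prob_le_diff; [exact: basin_01|exact: mu_basin_ge| |].
  by apply: measurableC; exact: measurable_tset.
apply: (@le_trans _ _ ((2 ^+ (k + 3))^-1 + ((Q k)%:R ^+ 5)^-1)%:E).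
  apply: (@measure_sub_le R _ _ mu _ _ ((basin `\` S k) `|` tset k L1)).
  - by apply: measurableI; [apply: measurableC; exact: measurable_tset|exact: measurable_basin].
  - by apply: measurableU; [apply: measurableD; [exact: measurable_basin|exact: measurable_towers12]
      |exact: measurable_tset].
  - move=> x [nt bx]; have [[i iS ti]|Sx] := pselect (S k x); last by left.
    by right; case: i iS ti.
  - apply: measureU_le; [|exact: measurable_tset|exact: mu_basin_towers12|exact: mu_tset_L1].
    by apply: measurableD; [exact: measurable_basin|exact: measurable_towers12].
rewrite lee_fin.
have -> : (2 ^+ (k + 2))^-1 = (2 ^+ (k + 3))^-1 + (2 ^+ (k + 3))^-1 :> R.
  have e : (k + 3 = (k + 2).+1)%N by lia.
  by rewrite e exprS invfM; lra.
rewrite lerD2l lef_pV2 ?posrE ?exprn_gt0 //.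
apply: (@le_trans _ _ ((Q k)%:R ^+ 1)).
  rewrite expr1 -natrX ler_nat; apply: leq_trans (gap_ge k).
  by rewrite leq_pexp2l // leq_add2l.
by rewrite ler_weXn2l // ler1n gap_gt0.
Qed.

Lemma lam3_tset k : (lam3 (~` tset k L3) <= ((2 ^+ k)^-1)%:E)%E.
Proof.
rewrite (_ : (2 ^+ k)^-1 = 4 * (2 ^+ (k + 2))^-1 :> R); last first.
  by rewrite exprD invfM mulrCA (_ : 4 / 2 ^+ 2 = 1) ?mulr1 // -natrX divff.
apply: restr_prob_le_diff; [exact: cobasin_01|exact: mu_cobasin_ge| |].
  by apply: measurableC; exact: measurable_tset.
apply: (@le_trans _ _ (((Q k)%:R ^+ 4 * 2 ^+ k)^-1 + ((Q k)%:R ^+ 5)^-1)%:E).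
  apply: (@measure_sub_le R _ _ mu _ _ ((S k `\` basin) `|` tset k L4)).
  - by apply: measurableI; [apply: measurableC; exact: measurable_tset|exact: measurable_cobasin].
  - by apply: measurableU; [apply: measurableD; [exact: measurable_towers12|exact: measurable_basin]
      |exact: measurable_tset].
  - move=> x [nt [x01 bx]]; have x01' : 0 <= x < 1 by move: x01; rewrite /= in_itv.
    have [Sx|[i iS ti]] := towers_cover v k x01'.
    + by left.
    + by right; case: i iS ti.
  - apply: measureU_le; [|exact: measurable_tset|exact: mu_towers12_basin|exact: mu_tset_L4].
    by apply: measurableD; [exact: measurable_towers12|exact: measurable_basin].
rewrite lee_fin.
have -> : (2 ^+ (k + 2))^-1 = (2 ^+ (k + 3))^-1 + (2 ^+ (k + 3))^-1 :> R.
  have e : (k + 3 = (k + 2).+1)%N by lia.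
  by rewrite e exprS invfM; lra.
have Qk : 2 ^+ (k + 3) <= (Q k)%:R :> R.
  rewrite -natrX ler_nat; apply: leq_trans (gap_ge k).
  by rewrite leq_pexp2l // leq_add2l.
have Q1 : 1 <= (Q k)%:R :> R by rewrite ler1n gap_gt0.
have Qpos : 0 < (Q k)%:R :> R := Q0 k.
apply: lerD; rewrite lef_pV2 ?posrE ?mulr_gt0 ?exprn_gt0 //.
  apply: le_trans Qk _; apply: (@le_trans _ _ ((Q k)%:R ^+ 4)).
    by rewrite -{1}[(Q k)%:R]expr1 ler_weXn2l.
  by rewrite ler_peMr ?exprn_ge0 // exprn_ege1 // ler1n.
apply: le_trans Qk _.
by rewrite -{1}[(Q k)%:R]expr1 ler_weXn2l.
Qed.

End Basin.

Lemma finite_measure_unique_ocitv (R : realType)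
    (m1 m2 : {measure set (measurableTypeR R) -> \bar R}) :
  (forall a b : R, m1 `]a, b]%classic = m2 `]a, b]%classic) ->
  (m1 setT < +oo)%E -> forall A, measurable A -> m1 A = m2 A.
Proof.
move=> H m1T A mA; apply: (@measure_unique _ R (measurableTypeR R) (@ocitv R) (fun n : nat => `]- (n%:R : R), n%:R]%classic)).
- by [].
- exact: ocitvI.
- by move=> n; exact: is_ocitv.
- apply/seteqP; split => // x _; exists (Num.bound `|x|).+1 => //=.
  rewrite in_itv /=; have : `|x| < (Num.bound `|x|).+1%:R.
    by apply: lt_trans (archi_boundP _) _ => //; rewrite ltr_nat.
  by rewrite ltr_norml => /andP[-> /ltW ->].
- by move=> _ [[a b] _ <-]; exact: H.
- move=> n; apply: le_lt_trans m1T; apply: le_measure; rewrite ?inE //.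
- exact: mA.
Qed.

Lemma real_le_inv (R : realType) (x c : R) : 0 <= x ->
  (forall k : nat, x <= c * k.+1%:R^-1) -> x = 0.
Proof.
move=> x0 H; apply: EFin_inj; apply: (@ereal_le_inv R _ c); first by rewrite lee_fin.
by move=> k; rewrite lee_fin.
Qed.

(** * Ergodicity of an invariant measure carried by a single tower at each stage *)

Section Ergodic.
Variables (R : realType) (v : keane_seq R).
Local Notation mu := (@lebesgue_measure R).
Local Notation T := (iet_map (v 0%N)).
Local Notation h := (height km kn).
Local Notation level := (level v).
Local Notation tset := (tset v).
Variables (lam : probability (measurableTypeR R) R) (i : letter).
Hypotheses (lam_inv : invariant_on01 T lam)
  (lam_tset : forall k, (lam (~` tset k i) <= ((2 ^+ k)^-1)%:E)%E)
  (lam_le : forall B : set (measurableTypeR R), measurable B -> (lam B <= 4%:E * mu B)%E).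
Implicit Types (A B : set (measurableTypeR R)) (k : nat).

Let p B := fine (lam B).

Let pE B : measurable B -> lam B = (p B)%:E.
Proof. by move=> mB; rewrite /p fineK // fin_num_measure. Qed.

Let p0 B : measurable B -> 0 <= p B.
Proof. by move=> mB; rewrite fine_ge0. Qed.

Let p1 B : measurable B -> p B <= 1.
Proof. by move=> mB; rewrite -lee_fin -pE // probability_le1. Qed.

Let p_near A B C c : measurable A -> measurable B -> measurable C ->
  A `\` B `<=` C -> B `\` A `<=` C -> (lam C <= c%:E)%E -> `|p A - p B| <= c.
Proof.
have half X Y : measurable X -> measurable Y -> measurable C -> X `\` Y `<=` C ->
    (lam C <= c%:E)%E -> p X <= p Y + c.
  move=> mX mY mC XY hc; rewrite -lee_fin -pE //.
  apply: (@measure_sub_le R _ _ lam _ _ (Y `|` C)) => //; first exact: measurableU.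
    by move=> x Xx; have [|Yx] := pselect (Y x); [left|right; apply: XY].
  have pY : (lam Y <= (p Y)%:E)%E by rewrite pE.
  exact: (measureU_le mY mC pY hc).
move=> mA mB mC AB BA hc; rewrite ler_distlC.
have := half _ _ mA mB mC AB hc; have := half _ _ mB mA mC BA hc.
by move=> ? ?; apply/andP; split; lra.
Qed.

Let mlev k j : measurable (level k i j). Proof. exact: measurable_level. Qed.

Lemma preimage_level k j : (j.+1 < h k i)%N -> T @^-1` level k i j.+1 = level k i j.
Proof.
move=> jh.
have lP j' x (jh' : (j' < h k i)%N) := @levelP R km kn v T (len_gt0 v) (len_keane v) (@iet_map_exchange R v) k i j' x jh'.
apply/seteqP; split => x; rewrite /preimage /= => /levelE.
  move=> /(lP _ _ jh)[z hz]; rewrite iterS => /(iet_map_inj (len_gt0 v 0%N)) xE.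
  by apply/levelE/lP; [exact: ltnW|exists z].
move=> /(lP _ _ (ltnW jh))[z hz xE]; apply/levelE/(lP _ _ jh); exists z => //.
by rewrite xE iterS.
Qed.

Lemma lam_level B k j : measurable B -> T @^-1` B = B -> (j < h k i)%N ->
  lam (B `&` level k i j) = lam (B `&` level k i 0).
Proof.
move=> mB TB; elim: j => // j IH jh; rewrite -IH; last exact: ltnW.
have [_ inv] := lam_inv; rewrite -(inv (B `&` level k i j.+1)); last exact: measurableI.
by rewrite preimage_setI TB preimage_level.
Qed.

Let pack k (P : pred nat) B : set (measurableTypeR R) :=
  \big[setU/set0]_(j < h k i | P j) (B `&` level k i j).

Let packP k P B x : pack k P B x <->
  exists2 j, (j < h k i)%N & [/\ P j, B x & level k i j x].
Proof.
rewrite /pack big_mkcond -(bigcup_mkord (h k i) (fun j => if P j then B `&` level k i j else set0)).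
split.
  by move=> [j jh]; case: ifP => // Pj [Bx lx]; exists j.
by move=> [j jh [Pj Bx lx]]; exists j => //=; rewrite Pj.
Qed.

Let mpack k P B : measurable B -> measurable (pack k P B).
Proof. by move=> mB; apply: bigsetU_measurable => j _; exact: measurableI. Qed.

Let p_pack k P B : measurable B -> T @^-1` B = B ->
  p (pack k P B) = (\sum_(j < h k i | P j) 1) * p (B `&` level k i 0).
Proof.
move=> mB TB; apply: EFin_inj; rewrite -pE; last exact: mpack.
rewrite measure_bigsetU_ord_cond.
- rewrite mulr_suml -sumEFin; apply: eq_bigr => j _.
  rewrite mul1r; transitivity (lam (B `&` level k i 0)); first exact: lam_level.
  by apply: pE; exact: measurableI.
- by move=> j _; exact: measurableI.
- apply/trivIsetP => j j' _ _ jj'; rewrite -subset0 => x [[_ /levelE h1] [_ /levelE h2]].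
  move/negP: jj'; apply; apply/eqP/val_inj.
  have lP (j0 : 'I_(h k i)) := @levelP R km kn v T (len_gt0 v) (len_keane v) (@iet_map_exchange R v) k i j0 x (ltn_ord j0).
  have [z hz xE] := (lP j).2 h1; have [z' hz' xE'] := (lP j').2 h2.
  rewrite xE in xE'.
  by have [] := @level_uniq R km kn v T (len_gt0 v) (len_keane v) (@iet_map_exchange R v) k i i z z' j j'
    hz hz' (ltn_ord j) (ltn_ord j') xE'.
Qed.

Let err k : R := 9 * k.+1%:R^-1.

Let lam_edge k (a : R) :
  (lam `[a, (a + v k i)%R[%classic <= (4 * k.+1%:R^-1)%:E)%E.
Proof.
apply: le_trans (lam_le _) _; first exact: measurable_itv.
rewrite lebesgue_co; last exact/ltW/len_gt0.
rewrite -EFinM lee_fin ler_wpM2l //.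
exact: le_trans (v_le_total v k i) (total_le v k).
Qed.

Let lam_out k : (lam (~` tset k i) <= (k.+1%:R^-1)%:E)%E.
Proof.
apply: le_trans (lam_tset k) _; rewrite lee_fin.
by rewrite lef_pV2 ?posrE ?exprn_gt0 ?ltr0n // -natrX ler_nat ltn_expl.
Qed.

(* An invariant set occupies the same proportion of all the levels of a tower,
   and intervals are almost unions of levels. *)
Lemma indep_interval B (a b : R) : measurable B -> T @^-1` B = B ->
  p (`]a, b]%classic `&` B) = p `]a, b]%classic * p B.
Proof.
move=> mB TB; set E : set (measurableTypeR R) := `]a, b]%classic.
have mE : measurable E by exact: measurable_itv.
apply/eqP; rewrite -subr_eq0 -normr_eq0; apply/eqP.
apply: (@real_le_inv R _ 36) => // k.
(* The levels starting in $]a,b]$ stand for the interval. The discrepancy lies in [C]: outside the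
   tower, or within the width of one level to the right of [a] or of [b]. Its measure has the
   constant 1 + 4 + 4 = 9, and four such errors make 36. *)
pose P j := a < level_end v T k i j <= b.
pose C : set (measurableTypeR R) := (~` tset k i `|` `[a, a + v k i[%classic) `|` `[b, b + v k i[%classic.
have mT : measurable (~` tset k i) by apply: measurableC; exact: measurable_tset.
have ma (c : R) : measurable (`[c, c + v k i[%classic : set (measurableTypeR R)) by exact: measurable_itv.
have mC : measurable C by do 2 apply: measurableU => //.
have lamC : (lam C <= (err k)%:E)%E.
  rewrite /err (_ : 9 * _ = k.+1%:R^-1 + 4 * k.+1%:R^-1 + 4 * k.+1%:R^-1); last by ring.
  apply: measureU_le; [exact: measurableU|exact: ma| |exact: lam_edge].
  by apply: measureU_le; [exact: mT|exact: ma|exact: lam_out|exact: lam_edge].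
have nearP D : measurable D -> `|p (E `&` D) - p (pack k P D)| <= err k.
  move=> mD; apply: (p_near _ _ mC _ _ lamC).
  - exact: measurableI.
  - exact: mpack.
  - move=> x [[]]; rewrite /E /= in_itv /= => /andP[ax xb] Dx nP.
    have [/tsetP[j jh lx]|] := pselect (tset k i x); last by left; left.
    have : ~ P j by move=> Pj; apply: nP; apply/packP; exists j.
    move/levelE: (lx); rewrite /P => /andP[l1 l2] nPj; left; right.
    rewrite /= in_itv /= (ltW ax) /=.
    have : level_end v T k i j <= a.
      by rewrite leNgt; apply/negP => al; apply: nPj; rewrite al /= (le_trans l1).
    by move: l2; set c := level_end _ _ _ _ _ => l2 ca; lra.
  - move=> x [/packP[j jh [/andP[Pa Pb] Dx lx]]] nE.
    move/levelE: (lx) => /andP[l1 l2]; right.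
    have bx : b < x.
      rewrite ltNge; apply/negP => xb; apply: nE; split => //.
      by rewrite /E /= in_itv /= xb andbT (lt_le_trans Pa).
    rewrite /= in_itv /= (ltW bx) /=.
    by move: l2 Pb; set c := level_end _ _ _ _ _ => l2 ca; lra.
have nearT D : measurable D -> `|p D - p (pack k xpredT D)| <= err k.
  move=> mD; apply: (p_near _ _ mC _ _ lamC) => //.
  - exact: mpack.
  - move=> x [Dx nP]; left; left => /tsetP[j jh lx]; apply: nP; apply/packP.
    by exists j.
  - by move=> x [/packP[j jh [_ Dx _]]].
have TT : T @^-1` setT = setT by rewrite preimage_setT.
have EB := nearP B mB; have ET := nearP setT measurableT.
have BB := nearT B mB; have BT := nearT setT measurableT.
have pT : p setT = 1 by rewrite /p probability_setT.
(* All levels meet an invariant set in the same mass, so both sides are the number of levels in [P]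
   times the number of all levels times the masses of level 0 and of its part in [B]. *)
have prod : p (pack k P B) * p (pack k xpredT setT) = p (pack k P setT) * p (pack k xpredT B).
  by rewrite !p_pack //; ring.
rewrite setIT in ET.
move: EB ET BB BT prod; rewrite pT.
have := p1 (mpack k P mB); have := p0 (mpack k P mB).
have := p1 (mpack k P measurableT); have := p0 (mpack k P measurableT).
have := p1 mB; have := p0 mB.
set X := p (E `&` B); set Y := p E; set Z := p B.
set X' := p (pack k P B); set Y' := p (pack k P setT); set Z' := p (pack k xpredT B).
set W' := p (pack k _ setT).
move=> Z0 Z1 Y0 Y1 X0 X1 EB ET BB BT prod.
have -> : 36 * k.+1%:R^-1 = err k + err k + (err k + err k) by rewrite /err; ring.
have -> : X - Y * Z = (X - X') + X' * (1 - W') - (Y' * (Z - Z') + (Y - Y') * Z).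
  have e : X' * (1 - W') = X' - Y' * Z' by rewrite -prod; ring.
  by rewrite e; ring.
apply: le_trans (ler_normB _ _) _; apply: lerD.
  apply: le_trans (ler_normD _ _) _; apply: lerD => //.
  rewrite normrM (ger0_norm X0); apply: le_trans BT.
  by rewrite ler_piMl.
apply: le_trans (ler_normD _ _) _; apply: lerD.
  by rewrite normrM (ger0_norm Y0); apply: le_trans BB; rewrite ler_piMl.
by rewrite normrM (ger0_norm Z0); apply: le_trans ET; rewrite ler_piMr.
Qed.

(** Independence of [B] from intervals extends to all Borel sets by uniqueness of measures; applied
    to [B] itself it says that its mass is its own square. *)
Lemma ergodic_of_towers : ergodic_on01 T lam.
Proof.
split => // B mB TB.
have H : forall A, measurable A -> mrestr lam mB A = mscale (NngNum (p0 mB)) lam A.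
  apply: finite_measure_unique_ocitv => [a b|]; last first.
    by rewrite /= /mrestr setTI pE // ltry.
  rewrite /= /mrestr /mscale /= !pE; [|exact: measurable_itv|].
    by rewrite -EFinM indep_interval // mulrC.
  by apply: measurableI => //; exact: measurable_itv.
have e : p B = p B * p B.
  have e0 : lam (B `&` B) = ((p B)%:E * lam B)%E := H B mB.
  by apply: EFin_inj; rewrite EFinM -[LHS]pE // -{1}[B]setIid e0 pE.
have : p B * (p B - 1) == 0 by rewrite mulrBr mulr1 -e subrr.
rewrite mulf_eq0 subr_eq0 pE // => /orP[]/eqP pB; [left|right]; by rewrite pB.
Qed.

End Ergodic.

Section LamErgodic.
Variables (R : realType) (v : keane_seq R).

Lemma lam2_ergodic : ergodic_on01 (iet_map (v 0%N)) (lam2 v).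
Proof.
apply: (@ergodic_of_towers R v _ L2); [exact: lam2_invariant|exact: lam2_tset|].
by move=> B mB; apply: restr_prob_le => //; [exact: basin_01|exact: mu_basin_ge].
Qed.

Lemma lam3_ergodic : ergodic_on01 (iet_map (v 0%N)) (lam3 v).
Proof.
apply: (@ergodic_of_towers R v _ L3); [exact: lam3_invariant|exact: lam3_tset|].
by move=> B mB; apply: restr_prob_le => //; [exact: cobasin_01|exact: mu_cobasin_ge].
Qed.

Lemma lam_distinct : lam2 v (basin v) <> lam3 v (basin v).
Proof.
have -> : lam3 v (basin v) = 0%E.
  rewrite /lam3 restr_probE; [|exact: cobasin_01|exact: mu_cobasin_ge].
  rewrite (_ : _ `&` _ = set0) ?measure0 ?mul0e //.
  by rewrite -subset0 => x [bx []].
have := restr_prob_ge (measurable_basin v) (@basin_01 R v) (mu_basin_ge v) (basin v).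
rewrite setIid => ge e; have := le_trans (mu_basin_ge v) ge.
by rewrite -/(lam2 v) e lee_fin; lra.
Qed.

End LamErgodic.

(** * Shrinking targets *)

Section MeasureTools.
Variable R : realType.
Local Notation mu := (@lebesgue_measure R).

Lemma limn_einf_eq0 (u : (\bar R)^nat) : (forall n, (0 <= u n)%E) ->
  (forall N (e : R), 0 < e -> exists2 n, (N <= n)%N & (u n <= e%:E)%E) ->
  limn_einf u = 0%E.
Proof.
move=> u0 H; rewrite limn_einf_lim.
have -> : einfs u = cst 0%E.
  apply/funext => N; apply/eqP; rewrite eq_le; apply/andP; split; last first.
    by apply: le_ereal_inf_tmp => _ [n _ <-].
  apply/lee_addgt0Pr => e e0; rewrite add0e.
  have [n Nn un] := H N e e0; apply: le_trans un.
  by apply: ereal_inf_lbound; exists n.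
exact: lim_cst.
Qed.

Lemma lim_sup_null d (S : measurableType d) (nu : {measure set S -> \bar R})
    (F : (set S)^nat) (c : R) : 0 <= c -> (forall k, measurable (F k)) ->
  (forall k, (nu (F k) <= (c / 2 ^+ k)%:E)%E) -> nu (lim_sup_set F) = 0%E.
Proof.
move=> c0 mF hF; apply: lim_sup_set_cvg0 => //.
apply: (@le_lt_trans _ _ (2 * c)%:E); last exact: ltry.
apply: le_trans (epsilon_trick0 xpredT (_ : 0 <= 2 * c)); last by rewrite mulr_ge0.
apply: lee_nneseries => // k _; apply: le_trans (hF k) _.
by rewrite natrX exprS invfM lee_fin; lra.
Qed.

(** Null sets in the two factors give a null cross in the product, so both limits reduce to separate
    conditions on [x] and on [y]. *)
Lemma ae_product (P1 P2 : probability (measurableTypeR R) R)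
    (X0 Y0 : set (measurableTypeR R)) (G : measurableTypeR R * measurableTypeR R -> Prop) :
  measurable X0 -> measurable Y0 -> P1 X0 = 0%E -> P2 Y0 = 0%E ->
  (forall x y, ~ X0 x -> ~ Y0 y -> G (x, y)) -> {ae (P1 \x P2)%E, forall z, G z}.
Proof.
move=> mX mY X00 Y00 H.
exists ((X0 `*` setT) `|` (setT `*` Y0)); split.
- by apply: measurableU; apply: measurableX.
- have e A B : measurable A -> measurable B -> (P1 \x P2)%E (A `*` B) = (P1 A * P2 B)%E.
    by move=> mA mB; exact: product_measure1E.
  have e1 : (P1 \x P2)%E (X0 `*` setT) = 0%E by rewrite e // X00 mul0e.
  have e2 : (P1 \x P2)%E (setT `*` Y0) = 0%E by rewrite e // Y00 mule0.
  by apply: null_set_setU e1 e2; apply: measurableX.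
- move=> [x y] /= nG; apply: contrapT => N; apply: nG; apply: H => h; apply: N.
    by left.
  by right.
Qed.

End MeasureTools.

(** * Minimality and the first limit *)

Section LiminfZero.
Variables (R : realType) (v : keane_seq R).
Local Notation mu := (@lebesgue_measure R).
Local Notation T := (iet_map (v 0%N)).
Local Notation h := (height km kn).
Local Notation tset := (tset v).
Local Notation lam2 := (lam2 v).
Local Notation lam3 := (lam3 v).
Local Notation d := (dist_sum lam2 lam3).
Implicit Types (x y : R) (k : nat).

Lemma iter_01 n x : (0 <= iter n T x < 1) = (0 <= x < 1).
Proof. by elim: n => //= n IH; rewrite T_01. Qed.

Lemma keane_minimal : minimal_on01 T.
Proof.
move=> x; rewrite in_itv /= => x01 y; rewrite /= in_itv /= => y01 B /nbhs_ballP[e /= e0 eB].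
pose k := Num.bound `|e^-1|.
have ke : k.+1%:R^-1 < e.
  rewrite -[ltRHS]invrK ltf_pV2 ?posrE ?invr_gt0 ?ltr0n //.
  apply: le_lt_trans (ler_norm _) _; apply: lt_trans (archi_boundP _) _ => //.
  by rewrite ltr_nat.
rewrite -(base0E v) in x01; rewrite -(base0E v) in y01.
have [t [_ tT]] := @dense_orbits R km kn v T km_gt0 kn_gt0 (len_gt0 v) (len_keane v) (@iet_map_exchange R v) k x y x01 y01.
exists (iter t T x); split; first by exists t.
apply: eB; rewrite /ball /= distrC; apply: lt_trans tT _.
exact: le_lt_trans (total_le v k) ke.
Qed.

Let J (a b : R) : set (measurableTypeR R) := `[Num.min a b, Num.max a b]%classic.

Let muJ a b : mu (J a b) = `|a - b|%:E.
Proof.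
rewrite /J lebesgue_measure_itv /= lte_fin; case: (ltgtP a b) => ab.
- by rewrite ab -EFinB ltr0_norm ?subr_lt0 // opprB.
- by rewrite ab -EFinB gtr0_norm ?subr_gt0.
- by rewrite ltxx ab subrr normr0.
Qed.

Let mJ a b : measurable (J a b). Proof. exact: measurable_itv. Qed.

Lemma dist_le a b : (d a b <= (8 * `|a - b|)%:E)%E.
Proof.
rewrite /dist_sum -/(J a b) (_ : 8 * _ = 4 * `|a - b| + 4 * `|a - b|); last by ring.
rewrite EFinD; apply: leeD; rewrite EFinM -muJ; apply: restr_prob_le => //.
- exact: basin_01.
- exact: mu_basin_ge.
- exact: cobasin_01.
- exact: mu_cobasin_ge.
Qed.

(** The basin and its complement partition $[0,1)$, and as neither has measure above 1, normalising
    does not decrease the measure of a part. *)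
Lemma dist_ge a b : 0 <= a < 1 -> 0 <= b < 1 -> (`|a - b|%:E <= d a b)%E.
Proof.
move=> a01 b01; rewrite /dist_sum -/(J a b) -muJ (lebesgueDI (mJ a b) (measurable_basin v)) addeC.
apply: leeD.
  apply: restr_prob_ge; [exact: basin_01|exact: mu_basin_ge].
rewrite (_ : J a b `\` basin v = J a b `&` cobasin v); last first.
  apply/seteqP; split => x; last by move=> [? []].
  move=> [Jx bx]; split => //; split => //; move: Jx; rewrite /J /= !in_itv /=.
  move=> /andP[h1 h2]; apply/andP; split.
    by apply: le_trans h1; rewrite le_min; case/andP: a01 => -> _; case/andP: b01.
  by apply: le_lt_trans h2 _; rewrite gt_max; case/andP: a01 => _ ->; case/andP: b01.
apply: restr_prob_ge; [exact: cobasin_01|exact: mu_cobasin_ge].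
Qed.

Lemma dist_ge0 a b : (0 <= d a b)%E.
Proof. by rewrite adde_ge0. Qed.

Lemma total_kn k : total (v k.+1) <= (kn k)%:R^-1.
Proof.
rewrite -[leRHS]mul1r ler_pdivlMr ?ltr0n ?kn_gt0 // -[leRHS](len_mass v k.+1) mulrC.
rewrite /mass12 /mass34 /total !mulrDr !addrA.
have H i : (kn k)%:R * v k.+1 i <= (h k.+1 i)%:R * v k.+1 i.
  by rewrite ler_wpM2r ?ler_nat ?(ltW (len_gt0 v _ _)) //; exact: kn_le_height.
by do 3 (apply: lerD => //).
Qed.

(** The growing exponent acts here: [kn k] to the power [e] is [Q k] to the power [(k + 6) * e], at
    least [Q k ^ 2]. One factor pays for the [Q k] in the bound on [n], the other one remains.
    Passing to [e = min(eps, 1)] keeps the exponent [1 - e] nonnegative, so that the power is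
    monotone in [n]. *)
Lemma powR_visit (eps : R) (n k : nat) : 0 < eps -> (0 < n)%N ->
  (n <= 11 * Q k * kn k)%N -> 2 <= (k + 6)%:R * Num.min eps 1 ->
  n%:R `^ (1 - eps) * (kn k)%:R^-1 <= 11 / (Q k)%:R.
Proof.
move=> eps0 n0 nle k2; set e := Num.min eps 1 in k2.
have Q1 : 1 <= (Q k)%:R :> R by rewrite ler1n gap_gt0.
have Qpos : 0 < (Q k)%:R :> R by rewrite ltr0n gap_gt0.
have e1 : e <= 1 by rewrite ge_min lexx orbT.
have eeps : e <= eps by rewrite ge_min lexx.
have e0 : 0 < e by rewrite lt_min eps0 ltr01.
rewrite ler_pdivrMr ?ltr0n ?kn_gt0 // mulrAC ler_pdivlMr //.
apply: (@le_trans _ _ ((11 * Q k * kn k)%:R `^ (1 - e) * (Q k)%:R)).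
  rewrite ler_wpM2r //; apply: (@le_trans _ _ (n%:R `^ (1 - e))).
    by apply: ler_powR; rewrite ?ler1n // lerD2l lerN2.
  by apply: ge0_ler_powR; rewrite ?subr_ge0 ?nnegrE // ler_nat.
rewrite natrM powRM // natrM.
have h1 : (11 * (Q k)%:R) `^ (1 - e) <= 11 * (Q k)%:R :> R.
  rewrite -[leRHS]powRr1 ?mulr_ge0 //; apply: ler_powR; last by lra.
  by lra.
have h2 : (kn k)%:R `^ (1 - e) * (Q k)%:R ^+ 2 <= (kn k)%:R.
  rewrite -powR_mulrn // /kn natrX -powR_mulrn // -powRrM -powRD; last first.
    by apply/implyP => _; rewrite gt_eqF.
  by apply: ler_powR => //; rewrite mulrBr mulr1; lra.
have kn0 : 0 <= (kn k)%:R `^ (1 - e) by exact: powR_ge0.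
apply: (@le_trans _ _ (11 * (Q k)%:R * (kn k)%:R `^ (1 - e) * (Q k)%:R)).
  by rewrite ler_wpM2r // ler_wpM2r.
rewrite (_ : _ * _ = 11 * ((kn k)%:R `^ (1 - e) * (Q k)%:R ^+ 2)); last by ring.
by rewrite ler_wpM2l.
Qed.

Lemma liminf_eq0 (eps : R) x y : 0 < eps -> 0 <= x < 1 ->
  (forall K, exists2 k, (K <= k)%N & tset k L3 y) ->
  limn_einf (fun n : nat => ((n%:R `^ (1 - eps))%:E * d (iter n T x) y)%E) = 0%E.
Proof.
move=> eps0 x01 yinf; apply: limn_einf_eq0 => [n|N e e0].
  by rewrite mule_ge0 ?dist_ge0 // lee_fin powR_ge0.
pose m := Num.min eps 1; have m0 : 0 < m by rewrite lt_min eps0 ltr01.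
(* The three terms put [k] above [N], give [2 <= (k + 6) * m] for [powR_visit], and make [Q k]
   exceed [88 / e], where 88 is 8 from [dist_le] times 11 from [powR_visit]. *)
pose K := (N.+1 + (Num.bound `|2 / m| + Num.bound `|88 / e|))%N.
have [k Kk ty] := yinf K.
have Qk : (k < Q k)%N.
  apply: leq_trans (gap_ge k); apply: leq_trans (ltn_expl k (isT : 1 < 2)%N) _.
  by rewrite leq_exp2l ?leq_addr.
have bd (c : R) : (Num.bound `|c| <= k)%N -> c <= k%:R.
  move=> ck; apply: le_trans (ler_norm _) _; apply: ltW; apply: lt_le_trans (archi_boundP _) _ => //.
  by rewrite ler_nat.
have x1b : base v 0 (iter N.+1 T x) by rewrite base0E iter_01.
have hH i : (h k.+1 i <= h k.+1 L2)%N by exact: height_le_L2.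
have [t tle [t01 td]] := @visit_tower_L3 R km kn v T km_gt0 kn_gt0 (len_gt0 v) (len_keane v)
  (@iet_map_exchange R v) k _ y _ hH x1b ty.
exists (t + N.+1)%N; first by lia.
rewrite iterD in td *; set z := iter t T _ in td *.
apply: (@le_trans _ _ (((t + N.+1)%:R `^ (1 - eps))%:E * (8 * (kn k)%:R^-1)%:E)%E).
  apply: lee_wpmul2l; first by rewrite lee_fin powR_ge0.
  apply: le_trans (dist_le _ _) _; rewrite lee_fin ler_wpM2l //.
  by apply: le_trans td _; rewrite len_keane; exact: total_kn.
rewrite -EFinM lee_fin mulrCA.
(* Twice the height bound [5 * Q k * kn k], plus one more [Q k * kn k] for the waiting time
   [N.+1]. *)
have nle : (t + N.+1 <= 11 * Q k * kn k)%N.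
  have := height2_le k; have := kn_gt0 k.
  have : (N.+1 <= Q k * kn k)%N.
    apply: (@leq_trans (Q k)); last by rewrite leq_pmulr // kn_gt0.
    by apply: leq_trans (ltnW Qk); rewrite /K in Kk; lia.
  by rewrite -!mulnA; set a := (Q k * kn k)%N; lia.
have k2 : 2 <= (k + 6)%:R * m.
  rewrite -ler_pdivrMr //; apply: (@le_trans _ _ k%:R); last by rewrite ler_nat leq_addr.
  by apply: bd; apply: leq_trans Kk; rewrite /K addnCA leq_addr.
have := @powR_visit eps (t + N.+1) k eps0 (ltn_addl _ (ltn0Sn N)) nle k2.
move=> H; apply: (@le_trans _ _ (8 * (11 / (Q k)%:R))); first by rewrite ler_wpM2l.
rewrite (_ : 8 * _ = 88 / (Q k)%:R); last by ring.
rewrite ler_pdivrMr ?ltr0n ?gap_gt0 // mulrC -ler_pdivrMr //.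
apply: (@le_trans _ _ k%:R); last by rewrite ler_nat ltnW.
by apply: bd; apply: leq_trans Kk; rewrite /K addnA leq_addl.
Qed.

End LiminfZero.

(** * The second limit *)

Section LiminfInfinity.
Variables (R : realType) (v : keane_seq R).
Local Notation mu := (@lebesgue_measure R).
Local Notation T := (iet_map (v 0%N)).
Local Notation h := (height km kn).
Local Notation tset := (tset v).
Local Notation level := (level v).
Local Notation level_end := (level_end v T).
Local Notation lam2 := (lam2 v).
Local Notation lam3 := (lam3 v).
Local Notation d := (dist_sum lam2 lam3).
Implicit Types (x y : R) (k : nat).

(** A geometric proportion of the width: small enough for the edges to be summable, and still at
    least the inverse of [Q k] owing to the factor [2 ^ (k + 6)] there. *)
Definition margin k : R := v k L2 / 2 ^+ k.

Lemma margin_ge0 k : 0 <= margin k.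
Proof. by rewrite divr_ge0 ?exprn_ge0 // ltW ?len_gt0. Qed.

(** The right end of the second interval is left unsimplified to have the form required by
    [lebesgue_co]. *)
Definition edge k j : set (measurableTypeR R) :=
  `[level_end k L2 j, level_end k L2 j + margin k[%classic `|`
  `[level_end k L2 j + v k L2 - margin k, level_end k L2 j + v k L2 - margin k + margin k[%classic.

Definition edges k : set (measurableTypeR R) := \big[setU/set0]_(j < h k L2) edge k j.

Lemma measurable_edge k j : measurable (edge k j).
Proof. by apply: measurableU; exact: measurable_itv. Qed.

Lemma measurable_edges k : measurable (edges k).
Proof. by apply: bigsetU_measurable => j _; exact: measurable_edge. Qed.

Lemma edgesP k x : edges k x <-> exists2 j, (j < h k L2)%N & edge k j x.
Proof. by rewrite /edges -bigcup_mkord; split=> -[j jh ?]; exists j. Qed.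

Lemma mu_edges k : (mu (edges k) <= (2 / 2 ^+ k)%:E)%E.
Proof.
apply: (@le_trans _ _ ((count xpredT (iota 0 (h k L2)))%:R * (margin k + margin k))%:E).
  apply: (@measure_union_le R _ _ mu _ xpredT (edge k)).
  - by rewrite addr_ge0 // margin_ge0.
  - exact: measurable_edges.
  - exact: measurable_edge.
  - move=> j; apply: measureU_le; try exact: measurable_itv.
      by rewrite -[leLHS]/(lebesgue_measure _) lebesgue_co ?margin_ge0.
    by rewrite -[leLHS]/(lebesgue_measure _) lebesgue_co ?margin_ge0.
  - by move=> x /edgesP[j jh ex]; exists j.
rewrite count_predT size_iota lee_fin /margin.
have : (h k L2)%:R * v k L2 <= 1.
  rewrite -[leRHS](len_mass v k) /mass12 /mass34.
  by have := (hv_ge0 v k L1, hv_ge0 v k L3, hv_ge0 v k L4) => -[[? ?] ?]; lra.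
move=> H; rewrite (_ : _ * _ = (2 / 2 ^+ k) * ((h k L2)%:R * v k L2)); last by ring.
by rewrite ler_piMr // divr_ge0 ?exprn_ge0.
Qed.

Lemma far_from_interior k y z : tset k L2 y -> ~ edges k y -> ~ tset k L2 z ->
  margin k <= `|z - y|.
Proof.
move=> /tsetP[j jh /levelE/andP[l1 l2]] ne nz.
have nzl : ~ level k L2 j z by move=> hz; apply: nz; apply/tsetP; exists j.
have {}ne : ~ edge k j y by move=> hy; apply: ne; apply/edgesP; exists j.
move: l1 l2 ne nzl; rewrite /edge levelE; set c := level_end _ _ _.
rewrite /setU /= !in_itv /= => l1 l2 ne nzl.
have y1 : c + margin k <= y.
  by rewrite leNgt; apply/negP => hy; apply: ne; left; rewrite l1.
have y2 : y < c + v k L2 - margin k.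
  by rewrite ltNge; apply/negP => hy; apply: ne; right; rewrite hy subrK.
rewrite ler_normr; have [zc|cz] := ltP z c; first by apply/orP; right; lra.
have [zv|vz] := ltP z (c + v k L2); first by exfalso; apply: nzl; rewrite cz zv.
by apply/orP; left; lra.
Qed.

(** Tower 2 has mass at least 1 - 5/8 - 1/8 = 1/4, and the spare factor [2 ^ 6] in [Q k] outweighs
    this 1/4. *)
Lemma margin_ge k : (Q k)%:R^-1 <= margin k.
Proof.
have key : (h k L1)%:R * v k L1 <= 8^-1.
  apply: (@le_trans _ _ (((Q k)%:R ^+ 5)^-1)).
    apply: le_trans (height_total_le v k).
    apply: ler_pM => //; [exact/ltW/len_gt0|by rewrite ler_nat height_le_L2|].
    rewrite len_keane /= /total.
    by have := (len_gt0 v k.+1 L1, len_gt0 v k.+1 L2) => -[? ?]; lra.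
  have q := gap_ge64 R k.
  rewrite lef_pV2 ?posrE ?exprn_gt0 //; last by lra.
  apply: (@le_trans _ _ (Q k)%:R); first by lra.
  by rewrite -{1}[(Q k)%:R]expr1 ler_weXn2l //; lra.
have h2 : 4^-1 <= (h k L2)%:R * v k L2.
  have := len_mass v k; have := len_mass34 v k; rewrite /mass12; lra.
rewrite /margin ler_pdivlMr ?exprn_gt0 // mulrC ler_pdivrMr ?ltr0n ?gap_gt0 //.
rewrite gapE natrM natrX exprD.
rewrite (_ : v k L2 * _ = 2 ^+ k * ((h k L2)%:R * v k L2 * 2 ^+ 6)); last by ring.
by rewrite ler_peMr ?exprn_ge0 //; lra.
Qed.

Definition hit k : set (measurableTypeR R) :=
  \big[setU/set0]_(n < Q k.+1 ^ 4) ((iter n T) @^-1` tset k L2).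

Lemma measurable_iter n (B : set (measurableTypeR R)) : measurable B ->
  measurable ((iter n T) @^-1` B).
Proof.
elim: n B => // n IH B mB.
have -> : (iter n.+1 T) @^-1` B = (iter n T) @^-1` (T @^-1` B) by [].
by apply: IH; exact: measurable_T.
Qed.

Lemma measurable_hit k : measurable (hit k).
Proof. by apply: bigsetU_measurable => n _; apply: measurable_iter; exact: measurable_tset. Qed.

Lemma hitP k x : hit k x <-> exists2 n, (n < Q k.+1 ^ 4)%N & tset k L2 (iter n T x).
Proof. by rewrite /hit -(bigcup_mkord _ (fun n => (iter n T) @^-1` tset k L2)); split=> -[j jh ?]; exists j. Qed.

Lemma lam3_iter n (B : set (measurableTypeR R)) : measurable B ->
  lam3 ((iter n T) @^-1` B) = lam3 B.
Proof.
have [_ inv] := lam3_invariant v.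
elim: n B => // n IH B mB.
have -> : (iter n.+1 T) @^-1` B = (iter n T) @^-1` (T @^-1` B) by [].
by rewrite IH ?inv //; exact: measurable_T.
Qed.

(* Towers 3 and 4 of stage [k.+1] avoid tower 2 of stage [k], so a point of
   [cobasin] in the latter lies in tower 1 or 2 of stage [k.+1]. *)
Lemma lam3_tset_L2 k : (lam3 (tset k L2) <= (4 * ((Q k.+1)%:R ^+ 4 * 2 ^+ k.+1)^-1)%:E)%E.
Proof.
apply: restr_prob_le_diff; [exact: cobasin_01|exact: mu_cobasin_ge|exact: measurable_tset|].
apply: (@measure_sub_le R _ _ mu _ _ (towers12 v k.+1 `\` basin v)).
- by apply: measurableI; [exact: measurable_tset|exact: measurable_cobasin].
- by apply: measurableD; [exact: measurable_towers12|exact: measurable_basin].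
- move=> x [tx [_ bx]]; split => //.
  by have [//|/(tset_L2_towers34 tx)] := towers_cover v k.+1 (tset_01 tx).
- exact: mu_towers12_basin.
Qed.

(** The number of times in the union bound cancels the fourth power in [lam3_tset_L2] and leaves a
    summable factor. *)
Lemma lam3_hit k : (lam3 (hit k) <= (2 / 2 ^+ k)%:E)%E.
Proof.
set w := 4 * ((Q k.+1)%:R ^+ 4 * 2 ^+ k.+1)^-1 : R.
apply: (@le_trans _ _ ((count xpredT (iota 0 (Q k.+1 ^ 4)))%:R * w)%:E).
  apply: (@measure_union_le R _ _ lam3 _ xpredT (fun n => (iter n T) @^-1` tset k L2)).
  - by rewrite mulr_ge0 // invr_ge0 mulr_ge0 // exprn_ge0.
  - exact: measurable_hit.
  - by move=> j; apply: measurable_iter; exact: measurable_tset.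
  - move=> j; apply: le_trans (lam3_tset_L2 k); rewrite le_eqVlt; apply/orP; left; apply/eqP.
    by apply: lam3_iter; exact: measurable_tset.
  - by move=> x /hitP[n nQ hn]; exists n.
rewrite count_predT size_iota lee_fin natrX /w.
have q0 : (Q k.+1)%:R ^+ 4 != 0 :> R by rewrite expf_neq0 // pnatr_eq0 -lt0n gap_gt0.
rewrite invfM mulrCA [X in 4 * X]mulrA divff // mul1r exprS invfM; lra.
Qed.

Lemma liminf_pinfty (eps : R) x y : 0 < eps -> 0 <= x < 1 -> 0 <= y < 1 ->
  (exists K, forall k, (K <= k)%N -> tset k L2 y /\ ~ edges k y) ->
  (exists K, forall k, (K <= k)%N -> ~ hit k x) ->
  limn_einf (fun n : nat => ((n%:R `^ (2^-1 + eps))%:E * d (iter n T x) y)%E) = +oo%E.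
Proof.
move=> eps0 x01 y01 [K1 hy] [K2 hx].
suff cv : (fun n : nat => ((n%:R `^ (2^-1 + eps))%:E * d (iter n T x) y)%E) @ \oo --> +oo%E.
  by have [-> _] := cvg_limn_einf_sup cv.
apply/cvgeyPge => M.
pose K := (K1 + (K2 + Num.bound `|M|))%N.
exists (Q K ^ 4)%N => // n /= Kn.
have [k Kk [Qkn nQ]] : exists2 k, (K <= k)%N & (Q k ^ 4 <= n)%N /\ (n < Q k.+1 ^ 4)%N.
  have ex : exists k, (n < Q k.+1 ^ 4)%N.
    exists n; have : (n < Q n.+1)%N.
      apply: leq_trans (gap_ge _); apply: leq_trans (ltn_expl n (isT : 1 < 2)%N) _.
      by rewrite leq_exp2l // addSnnS leq_addr.
    move=> /leq_trans; apply; rewrite -{1}[Q n.+1]expn1 leq_pexp2l //; exact: gap_gt0.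
  case: (ex_minnP ex) => k kn kmin.
  have [kK|Kk] := ltnP k K.
    exfalso; move: kn; rewrite ltnNge => /negP; apply.
    by apply: leq_trans Kn; rewrite leq_exp2r // gap_le.
  exists k => //; split => //.
  (* Minimality says nothing for [k = 0]; then [K = 0] and the lower bound is the assumption [Kn] on
     [n]. *)
  case: k kn kmin Kk => [|k] kn kmin Kk.
    by move: Kn; move: Kk; rewrite leqn0 => /eqP ->.
  by rewrite leqNgt; apply/negP => /kmin; rewrite ltnn.
have [ty ney] := hy k (leq_trans (leq_addr _ _) Kk).
have nh := hx k (leq_trans _ Kk).
have {}nh : ~ tset k L2 (iter n T x).
  move=> tn; apply: nh; first by rewrite /K addnCA leq_addr.
  by apply/hitP; exists n.
have far := far_from_interior ty ney nh.
have Qpos : 0 < (Q k)%:R :> R by rewrite ltr0n gap_gt0.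
have n1 : 1 <= n%:R :> R.
  by rewrite ler1n; apply: leq_trans Qkn; rewrite expn_gt0 gap_gt0.
have pow : (Q k)%:R ^+ 2 <= n%:R `^ (2^-1 + eps).
  apply: (@le_trans _ _ (n%:R `^ 2^-1)); last first.
    by apply: ler_powR => //; rewrite lerDl ltW.
  rewrite powR12_sqrt // -[leLHS]ger0_norm ?exprn_ge0 // -sqrtr_sqr ler_sqrt //.
  by rewrite -exprM -natrX ler_nat.
apply: (@le_trans _ _ (((Q k)%:R ^+ 2)%:E * ((Q k)%:R^-1)%:E)%E).
  rewrite -EFinM lee_fin expr2 mulfK ?gt_eqF //.
  apply: le_trans (ler_norm _) _; apply: ltW; apply: lt_le_trans (archi_boundP _) _ => //.
  rewrite ler_nat; apply: (@leq_trans k).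
    by apply: leq_trans Kk; rewrite /K addnA leq_addl.
  apply: leq_trans (gap_ge k); apply: leq_trans (ltnW (ltn_expl k (isT : 1 < 2)%N)) _.
  by rewrite leq_exp2l ?leq_addr.
apply: lee_pmul; rewrite ?lee_fin ?exprn_ge0 ?invr_ge0 //.
apply: (@le_trans _ _ `|iter n T x - y|%:E); last by apply: dist_ge => //; rewrite iter_01.
by rewrite lee_fin; apply: le_trans (margin_ge k) far.
Qed.

Definition bad2 k : set (measurableTypeR R) := ~` tset k L2 `|` edges k.

Lemma lam2_bad k : (lam2 (bad2 k) <= (9 / 2 ^+ k)%:E)%E.
Proof.
rewrite (_ : 9 / _ = (2 ^+ k)^-1 + 4 * (2 / 2 ^+ k)); last by ring.
apply: measureU_le.
- by apply: measurableC; exact: measurable_tset.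
- exact: measurable_edges.
- exact: lam2_tset.
- apply: restr_prob_le_diff; [exact: basin_01|exact: mu_basin_ge|exact: measurable_edges|].
  apply: (@measure_sub_le R _ _ mu _ _ (edges k)).
  + by apply: measurableI; [exact: measurable_edges|exact: measurable_basin].
  + exact: measurable_edges.
  + by move=> x [].
  + exact: mu_edges.
Qed.

Lemma not_lim_sup (F : (set (measurableTypeR R))^nat) x : ~ lim_sup_set F x ->
  exists K, forall k, (K <= k)%N -> ~ F k x.
Proof.
move=> H; apply: contrapT => N; apply: H => n _.
apply: contrapT => N'; apply: N; exists n => k nk Fx; apply: N'; by exists k.
Qed.

Lemma measurable_lim_sup (F : (set (measurableTypeR R))^nat) :
  (forall k, measurable (F k)) -> measurable (lim_sup_set F).
Proof.
move=> mF; apply: bigcap_measurable; first by exists 0%N.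
by move=> k _; apply: bigcup_measurable.
Qed.

Let out01 : set (measurableTypeR R) := ~` `[0, 1[%classic.

Let mout : measurable out01. Proof. by apply: measurableC; exact: measurable_itv. Qed.

Let in01 x : ~ out01 x -> 0 <= x < 1.
Proof. by move=> /contrapT; rewrite /= in_itv. Qed.

Let null_out (P : probability (measurableTypeR R) R) : P `[0, 1[%classic = 1%E -> P out01 = 0%E.
Proof.
move=> P1; rewrite /out01 probability_setC; last exact: measurable_itv.
by rewrite P1 subee.
Qed.

Lemma ae_eq0 (eps : R) : 0 < eps ->
  {ae (lam2 \x lam3)%E, forall z : measurableTypeR R * measurableTypeR R,
    limn_einf (fun n : nat =>
      ((n%:R `^ (1 - eps))%:E * d (iter n T z.1) z.2)%E) = 0%E}.
Proof.
move=> eps0; have mF k : measurable (~` tset k L3).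
  by apply: measurableC; exact: measurable_tset.
apply: (@ae_product R lam2 lam3 out01 (lim_sup_set (fun k => ~` tset k L3))).
- exact: mout.
- exact: measurable_lim_sup.
- by apply: null_out; have [] := lam2_invariant v.
- apply: (@lim_sup_null R _ _ lam3 _ 1) => // k.
  by rewrite mul1r; exact: lam3_tset.
- move=> x y hx /not_lim_sup[K hK]; apply: liminf_eq0 => //; first exact: in01.
  move=> K'; exists (maxn K K'); first exact: leq_maxr.
  by apply: contrapT; apply: hK; exact: leq_maxl.
Qed.

Lemma ae_pinfty (eps : R) : 0 < eps ->
  {ae (lam3 \x lam2)%E, forall z : measurableTypeR R * measurableTypeR R,
    limn_einf (fun n : nat =>
      ((n%:R `^ (2^-1 + eps))%:E * d (iter n T z.1) z.2)%E) = +oo%E}.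
Proof.
move=> eps0.
have mb k : measurable (bad2 k).
  apply: measurableU; last exact: measurable_edges.
  by apply: measurableC; exact: measurable_tset.
apply: (@ae_product R lam3 lam2 (out01 `|` lim_sup_set hit) (out01 `|` lim_sup_set bad2)).
- by apply: measurableU; [exact: mout|apply: measurable_lim_sup; exact: measurable_hit].
- by apply: measurableU; [exact: mout|exact: measurable_lim_sup].
- apply: null_set_setU; [exact: mout|apply: measurable_lim_sup; exact: measurable_hit| |].
    by apply: null_out; have [] := lam3_invariant v.
  apply: (@lim_sup_null R _ _ lam3 _ 2) => // k; [exact: measurable_hit|exact: lam3_hit].
- apply: null_set_setU; [exact: mout|exact: measurable_lim_sup| |].
    by apply: null_out; have [] := lam2_invariant v.
  by apply: (@lim_sup_null R _ _ lam2 _ 9) => // k; exact: lam2_bad.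
- move=> x y nx ny; apply: liminf_pinfty => //.
  + by apply: in01 => hx; apply: nx; left.
  + by apply: in01 => hy; apply: ny; left.
  + have [K hK] : exists K, forall k, (K <= k)%N -> ~ bad2 k y.
      by apply: not_lim_sup => hy; apply: ny; right.
    exists K => k /hK nb; split; last by move=> ey; apply: nb; right.
    by apply: contrapT => nt; apply: nb; left.
  + by apply: not_lim_sup => hx; apply: nx; right.
Qed.

End LiminfInfinity.

Theorem theorem5 (R : realType) :
  exists (l : 'I_4 -> R) (s : 'S_4)
         (lam2 lam3 : probability (measurableTypeR R) R),
    let T := iet l s in
    let d := dist_sum lam2 lam3 in
    iet_lengths l /\
    minimal_on01 T /\
    ergodic_on01 T lam2 /\
    ergodic_on01 T lam3 /\
    (exists A : set (measurableTypeR R), measurable A /\ lam2 A <> lam3 A) /\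
    forall eps : R, 0 < eps ->
      {ae (lam2 \x lam3)%E, forall z : measurableTypeR R * measurableTypeR R,
        limn_einf (fun n : nat =>
          ((n%:R `^ (1 - eps))%:E * d (iter n T z.1) z.2)%E) = 0%E} /\
      {ae (lam3 \x lam2)%E, forall z : measurableTypeR R * measurableTypeR R,
        limn_einf (fun n : nat =>
          ((n%:R `^ (2^-1 + eps))%:E * d (iter n T z.1) z.2)%E) = +oo%E}.
Proof.
have [v [v0 vE v1 vS vU]] := keane_lengths R.
pose K := KeaneSeq v0 vE v1 vS vU.
exists (fun j : 'I_4 => K 0%N (letter_of j)), keane_perm, (lam2 K), (lam3 K).
rewrite (_ : iet _ _ = iet_map (K 0%N)); last first.
  by apply/funext => x; exact: iet_letter (v0 0%N).
move=> T d; split; first exact: iet_lengths_letter (v0 0%N) (total0 K).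
split; first exact: keane_minimal.
split; first exact: lam2_ergodic.
split; first exact: lam3_ergodic.
split; first by exists (basin K); split; [exact: measurable_basin|exact: lam_distinct].
by move=> eps eps0; split; [exact: ae_eq0|exact: ae_pinfty].
Qed.
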